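(* Let $S$ be a finite totally ordered set and $W$ a wall over $S$. If the set $\mathrm{Succ}(W)$ of pairs of successive bricks of $W$ is not empty, then the colouring complex $C_\bullet^{\mathrm{Col}}(W)$ is acyclic.
   Context: $S$ is non-empty, with total order $<_S$. For a poset $K$, $\mathrm{Succ}(K)$ is the set of pairs $(k,l)$ with $k<l$ and no element strictly between them. The height $\mathfrak{h}(x)$ of an element $x$ of a poset is the maximal number of elements of a chain ending at $x$. A wall over $S$ is a finite family $W=\{W_\alpha\}_{\alpha\in A}$, $|A|\geq 1$, of non-empty subsets of $S$ (bricks; equal subsets with different indices are allowed) with $\bigcup_\alpha W_\alpha=S$, together with, for each $s\in S$, a total order $\leqslant_s$ on $\Gamma_s=\{W_\alpha\mid s\in W_\alpha\}$, such that $\leqslant_s$ and $\leqslant_t$ agree on $\Gamma_s\cap\Gamma_t$ for all $s,t\in S$; $W$ is a poset for the canonical partial order $\leqslant_W$ generated by the $\leqslant_s$. A wall is connected if any two of its bricks can be joined by a finite sequence of its bricks in which consecutive terms have non-empty intersection and are successive, in one order or the other. Every wall decomposes uniquely into connected components. A colouring of $W$ is a surjective map $\phi:W\twoheadrightarrow C$ onto a set $C$ of colours such that: (1) the binary relation $\leqslant_\phi$ on $C$ defined by ''$c_1\leqslant_\phi c_2$ if there exist $k_1\in\phi^{-1}(c_1)$, $k_2\in\phi^{-1}(c_2)$ with $k_1\leqslant_W k_2$'' is a partial order; (2) for each $c\in C$, the fiber $\phi^{-1}(c)$ is a connected wall over $S_c=\bigcup_{W_\alpha\in\phi^{-1}(c)}W_\alpha$.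 Two colourings $\phi:W\to C$, $\psi:W\to D$ are isomorphic if there is an isomorphism of posets $\Phi:(C,\leqslant_\phi)\to(D,\leqslant_\psi)$ with $\Phi\phi=\psi$. $\mathrm{Col}_n(W)$ is the set of isomorphism classes of colourings of $W$ with $n$ colours ($n\geq 1$). $\mathrm{Succ}(\phi)$ is the set of pairs of successive colours for $\leqslant_\phi$. For $(c<d)\in\mathrm{Succ}(\phi)$, let $\pi_c^d:C\to C/(c\sim d)$ be the map identifying the two colours $c$ and $d$; the composite $\pi_c^d\circ\phi$ is again a colouring. The order $<_W$ extends to a total order $\prec_W$ on $W$: $W_a\prec_W W_b$ if either $W_a\cap W_b\neq\varnothing$ and $W_a<_W W_b$; or $W_a\cap W_b=\varnothing$ and $\mathfrak{h}(W_a)<\mathfrak{h}(W_b)$; or $W_a\cap W_b=\varnothing$, $\mathfrak{h}(W_a)=\mathfrak{h}(W_b)$ and $\min(W_a)<_S\min(W_b)$. For a colouring $\phi:W\to C$, $\prec_W$ induces the total order $\prec_\phi$ on $C$: $c_1\prec_\phi c_2$ if there exist $k_1\in\phi^{-1}(c_1)$, $k_2\in\phi^{-1}(c_2)$ with $k_1\prec_W k_2$. The colouring complex $C_\bullet^{\mathrm{Col}}(W)$ is the $\mathbb{Z}$-linearization of the graded set $\mathrm{Col}_\bullet(W)$, i.e. $C_n^{\mathrm{Col}}(W)=\mathbb{Z}[\mathrm{Col}_n(W)]$, with differential $$\partial(W,\phi)=\sum_{(c<d)\in\mathrm{Succ}(\phi)}(-1)^{\Lambda}\,(W,\pi_c^d\circ\phi),$$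 $$\Lambda=\#\{x\in\phi(W)\mid x\prec_\phi d,\ x\neq c\}+\#\{x\in\phi(W)\mid c\prec_\phi x\prec_\phi d,\ (x<d)\in\mathrm{Succ}(\phi)\}.$$ If $W$ is not connected, with connected components $W^1,\dots,W^l$, then $C_\bullet^{\mathrm{Col}}(W)\cong\bigotimes_{i=1}^l C_\bullet^{\mathrm{Col}}(W^i)$.
   Formalization: The order on colours is the transitive closure of the stated relation. As the stated signs do not always give ∂∂=0, acyclicity is proved for Λ whenever ∂∂=0, and for every such wall with a corrected exponent that compares colours by their least bricks. *)

(* Defs.v *)
From HB Require Import structures.
From mathcomp Require Import all_boot all_order all_algebra.

Set Implicit Arguments.
Unset Strict Implicit.
Unset Printing Implicit Defensive.

Import Order.TTheory GRing.Theory Num.Theory.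

(* Given a partial order le on T, the pair (x, y) belongs to Succ. When le    *)
(* only relates distinct elements inside a subset K of T, this is Succ(K).    *)
Definition strict (T : eqType) (le : rel T) : rel T :=
  fun x y => (x != y) && le x y.

Definition is_succ (T : finType) (le : rel T) : rel T :=
  fun x y => strict le x y && ~~ [exists z, strict le x z && strict le z y].

Definition is_chain (T : finType) (le : rel T) (K : {set T}) : bool :=
  [forall x in K, forall y in K, le x y || le y x].

Definition height (T : finType) (le : rel T) (x : T) : nat :=
  \max_(K : {set T} | [&& is_chain le K, x \in K & [forall y in K, le y x]])
     #|K|.

Section Walls.

Variables (disp : Order.disp_t) (S : finOrderType disp).

(* Bricks are handled through their indices, so that equal subsets with       *)
(* different indices are different bricks. [gen_le A Gam le K] is the         *)
(* relation generated by the orders <=_s restricted to the bricks of K; it is *)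
(* the identity outside K.                                                    *)
Definition gen_step (A : finType) (brick : A -> {set S}) (le : S -> rel A)
    (K : {set A}) : rel A :=
  fun a b => [&& a \in K, b \in K &
    [exists s, [&& s \in brick a, s \in brick b & le s a b]]].

Definition gen_le (A : finType) (brick : A -> {set S}) (le : S -> rel A)
    (K : {set A}) : rel A :=
  connect (gen_step brick le K).

(* S is automatically non-empty. Antisymmetry of the generated relation is    *)
(* an axiom, because it does not follow from the compatibility of the <=_s:   *)
(* take the bricks {1,2}, {1,3}, {2,3}, each smaller than the next one in     *)
(* cyclic order.                                                              *)
Record wall : Type := Wall {
  bidx : finType;
  brick : bidx -> {set S};
  brick_le : S -> rel bidx;
  bidx_gt0 : (0 < #|bidx|)%N;
  brick_neq0 : forall a, exists s, s \in brick a;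
  brick_cover : forall s, exists a, s \in brick a;
  brick_le_refl : forall s a, s \in brick a -> brick_le s a a;
  brick_le_anti : forall s a b, s \in brick a -> s \in brick b ->
    brick_le s a b -> brick_le s b a -> a = b;
  brick_le_trans : forall s a b c,
    s \in brick a -> s \in brick b -> s \in brick c ->
    brick_le s a b -> brick_le s b c -> brick_le s a c;
  brick_le_total : forall s a b, s \in brick a -> s \in brick b ->
    brick_le s a b || brick_le s b a;
  brick_le_agree : forall s t a b,
    s \in brick a -> s \in brick b -> t \in brick a -> t \in brick b ->
    brick_le s a b = brick_le t a b;
  gen_le_anti : antisymmetric (gen_le brick brick_le [set: bidx])
}.

Variable W : wall.
Local Notation A := (bidx W).

Definition sub_le (K : {set A}) : rel A := gen_le (@brick W) (@brick_le W) K.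

Definition wall_le : rel A := sub_le [set: A].

(* A non-empty set K of bricks, with the restrictions of the <=_s, satisfies  *)
(* all the axioms of a wall over the union of its bricks, with generated      *)
(* order [sub_le K]; this says that this wall is connected.                   *)
Definition connected_bricks (K : {set A}) : bool :=
  [forall a in K, forall b in K,
    connect (fun x y => [&& x \in K, y \in K, brick x :&: brick y != set0
                          & is_succ (sub_le K) x y || is_succ (sub_le K) y x])
      a b].

Definition brick_min (a : A) : S :=
  [arg min_(s < xchoose (brick_neq0 a) in brick a) s]%O.

Definition brick_prec : rel A := fun a b =>
  if brick a :&: brick b != set0 then strict wall_le a b
  else (height wall_le a < height wall_le b)%N
       || (height wall_le a == height wall_le b)
          && (brick_min a < brick_min b)%O.

(* Since a colouring never needs more than #|A| colours, up to isomorphism    *)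
(* every colouring has its colours in A, the set of colours being the image,  *)
(* onto which the map is then surjective.                                     *)
Definition cmap := {ffun A -> A}.

Implicit Types phi psi : cmap.

Definition colours phi : {set A} := [set phi a | a : A].

Definition fiber phi (c : A) : {set A} := [set a | phi a == c].

(* The order of a colouring is generated by the relation: some brick of       *)
(* colour c1 is below some brick of colour c2. Without taking the transitive  *)
(* closure, identifying two successive colours of a colouring would not       *)
(* always give a colouring: for the wall {2} < {1,2} > {1,3} < {3}, merging   *)
(* the two middle bricks gives colours c1, c2, c3 with c1 <= c2 and c2 <= c3, *)
(* whereas {2} and {3} are not comparable.                                    *)
Definition col_rel phi : rel A := fun c1 c2 =>
  [exists k1 in fiber phi c1, exists k2 in fiber phi c2, wall_le k1 k2].

Definition col_le phi : rel A := connect (col_rel phi).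

Definition is_colouring phi : bool :=
  [forall c, forall d, col_le phi c d && col_le phi d c ==> (c == d)]
  && [forall c in colours phi, connected_bricks (fiber phi c)].

Definition col_iso phi psi : bool :=
  [exists F : {ffun A -> A},
    [&& dinjectiveb F (mem (colours phi)),
        F @: colours phi == colours psi,
        [forall c in colours phi, forall d in colours phi,
           col_le phi c d == col_le psi (F c) (F d)]
      & [forall a, F (phi a) == psi a]]].

Definition Col (n : nat) : {set {set cmap}} :=
  equivalence_partition col_iso
    [set phi | is_colouring phi && (#|colours phi| == n)].

(* phi followed by the map identifying d with c. *)
Definition col_merge phi (c d : A) : cmap :=
  [ffun a => if phi a == d then c else phi a].

Definition col_succ phi : rel A := is_succ (col_le phi).

Definition col_prec phi : rel A := fun c1 c2 =>
  (c1 != c2) &&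
  [exists k1 in fiber phi c1, exists k2 in fiber phi c2, brick_prec k1 k2].

Definition Lambda phi (c d : A) : nat :=
  #|[set x in colours phi | col_prec phi x d & x != c]|
  + #|[set x in colours phi | [&& col_prec phi c x, col_prec phi x d
                                & col_succ phi x d]]|.

(* The relation [col_prec phi] is not always a total order, as the fibers may *)
(* be interleaved, and then the signs (-1) ^+ Lambda need not square to zero. *)
(* Take S = {0 < 1}, four bricks k0, k1 = {0}, k2 = {1}, k3 = {0,1},          *)
(* k0 < k1 < k3 and k2 < k3, and the fibers {k0,k1}, {k2}, {k3}: both         *)
(* composites to the one-coloured map have sign +. [col_prec_min phi]         *)
(* compares the [brick_prec]-least bricks of the fibers: it is always a total *)
(* order on the colours, contained in [col_prec phi]. [Lambda_min] is the     *)
(* Koszul exponent of the merging of c and d, for colours of degree 1 listed  *)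
(* in this order; it has the same first term as [Lambda].                     *)
Definition col_prec_min phi : rel A := fun c1 c2 =>
  [exists k1 in fiber phi c1, forall k2 in fiber phi c2, brick_prec k1 k2].

Definition Lambda_min phi (c d : A) : nat :=
  #|[set x in colours phi | col_prec_min phi x d & x != c]|
  + #|[set x in colours phi | ((x == d) || col_prec_min phi d x)
                              & col_prec_min phi x c]|.

Local Open Scope ring_scope.

(* The free abelian group on the finite set Col n. *)
Definition col_chain (n : nat) := {ffun {x | x \in Col n} -> int}.

Definition col_gen (n : nat) psi : col_chain n :=
  [ffun y : {x | x \in Col n} => (psi \in val y)%:R].

(* A representative of a class; the summands of [col_bdry] do not depend on   *)
(* its choice. The default value is never used.                               *)
Definition col_repr (n : nat) (x : {x | x \in Col n}) : cmap :=
  odflt [ffun a => a] [pick phi in val x].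

Definition col_bdry (L : cmap -> A -> A -> nat) (n : nat)
    (u : col_chain n.+1) : col_chain n :=
  \sum_(x : {x | x \in Col n.+1})
    \sum_(p : A * A | col_succ (col_repr x) p.1 p.2)
      col_gen n (col_merge (col_repr x) p.1 p.2)
        *~ (u x * (-1) ^+ L (col_repr x) p.1 p.2).

Definition is_complex (L : cmap -> A -> A -> nat) : Prop :=
  forall (n : nat) (u : col_chain n.+2),
    col_bdry L (col_bdry L u) = 0.

(* Exactness in every degree n.+1. As Col 0 is empty, the group in degree 0   *)
(* vanishes, and every chain of degree 1 is a cycle.                          *)
Definition acyclic (L : cmap -> A -> A -> nat) : Prop :=
  forall (n : nat) (u : col_chain n.+1),
    col_bdry L u = 0 <-> exists v : col_chain n.+2, col_bdry L v = u.

End Walls.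

(* Main.v *)
Require Import Defs.
From HB Require Import structures.
From mathcomp Require Import all_boot all_order all_algebra.
From mathcomp Require Import zify.

(* Isomorphism classes of colourings are partitions of the bricks into         *)
(* connected blocks with acyclic quotient, that is, the faces of the order     *)
(* cone of the wall. Fix a maximal brick m with some brick below it. Deleting  *)
(* m from its block and cutting the rest of the block into its connected       *)
(* components gives an invariant [gam] that merging can only make coarser. The *)
(* colourings with a given invariant form a Boolean lattice: the block of m    *)
(* consists of m and of an arbitrary set of lower covers of m in the quotient  *)
(* by the invariant. Toggling one chosen lower cover, the pivot, is therefore  *)
(* a perfect matching, and the boundary is triangular with entries 1 or -1     *)
(* along it, so that the complex is exact. The signs play no role in this      *)
(* argument, apart from the fact that the boundary squares to zero. For        *)
(* [Lambda_min] the latter holds because the two ways of merging the same      *)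
(* colours in two steps are exchanged by a sign-reversing involution.          *)

Set Implicit Arguments.
Unset Strict Implicit.
Unset Printing Implicit Defensive.

Import Order.TTheory GRing.Theory Num.Theory.

(** * Colourings as partitions of the bricks *)

(** By [col_isoE] a class of colourings is a partition of the bricks, and the boundary merges two
    blocks that are successive in the quotient order. Call a colouring up if its pivot lies outside
    the block of [m], and low otherwise. Merging the pivot into the block of [m] keeps the invariant
    [gam] ([gam_match_merge]) and turns an up colouring into a low one; [low_split] and
    [kern_up_inj] show that this is a bijection on classes. Any other merge of an up colouring
    either coarsens the invariant, which lowers [rank], or keeps it and does not give a low
    colouring ([match_merge_unique]).

    Hence the incidence matrix from up classes to low classes is triangular for [rank], with entries
    1 or -1 on matched pairs. By [matching_exact], a cycle agrees on the low classes with some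
    boundary; the difference is a cycle carried by the up classes, and such a cycle vanishes. This
    gives [complex_acyclic] for every exponent whose boundary squares to zero. For [Lambda_min],
    [flip_merges] pairs the two-step merges having the same result, [odd_Lambda_flip] gives the
    pairs opposite signs, and [sum_flip] cancels them. *)

Section Connect.

Variables (T : finType).
Implicit Types (e : rel T).

Lemma connect_ind e (P : T -> T -> Prop) :
    (forall x, P x x) ->
    (forall x y z, e x y -> connect e y z -> P y z -> P x z) ->
  forall x y, connect e x y -> P x y.
Proof.
move=> P0 PS x y /connectP[p]; elim: p x => [|z p IH] x /=; first by move=> _ ->.
case/andP=> exz pzp yE; apply: (PS _ z) => //; last exact: IH.
by apply/connectP; exists p.
Qed.

Lemma connect_mono e e' : subrel e e' -> subrel (connect e) (connect e').
Proof. by move=> ee'; apply: connect_sub => x y /ee'; apply: connect1. Qed.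

Lemma connect_equiv e : equivalence_rel e -> connect e =2 e.
Proof.
move=> /equivalence_relP[er et] x y; apply/idP/idP; last exact: connect1.
by move: x y; apply: connect_ind => [x|x y z /et -> //]; exact: er.
Qed.

Lemma root_equiv e x y : equivalence_rel e ->
  (fingraph.root e x == fingraph.root e y) = e x y.
Proof.
move=> eE; rewrite root_connect ?connect_equiv // => {x y}x y.
rewrite !connect_equiv //; have [er et] := (equivalence_relP _).1 eE.
by apply/idP/idP => /et <-.
Qed.

Lemma connect_first e x y : connect e x y -> x != y ->
  exists z, [/\ e x z, x != z & connect e z y].
Proof.
move: x y; apply: connect_ind => [x|x y z exy cyz IH xz]; first by rewrite eqxx.
have [xy|xy] := eqVneq x y; last by exists y.
by rewrite {1 2}xy; apply: IH; rewrite -xy.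
Qed.

Lemma connect_last e x y : connect e x y -> x != y ->
  exists z, [/\ e z y, z != y & connect e x z].
Proof.
move: x y; apply: connect_ind => [x|x y z exy cyz IH xz]; first by rewrite eqxx.
have [yz|yz] := eqVneq y z; first by exists x; rewrite -yz in xz *.
have [w [ewz wz cyw]] := IH yz; exists w; split=> //.
exact: connect_trans (connect1 exy) cyw.
Qed.

(** An interval with an interior point is split there, and both halves are smaller. In an interval
    without interior point, the first non-trivial generating step must already reach the top. *)
Lemma connect_succ e : antisymmetric (connect e) ->
  subrel (connect e) (connect (fun x y => e x y && is_succ (connect e) x y)).
Proof.
move=> ea x y.
pose I x y := [set z | connect e x z && connect e z y].
have [n] := ubnP #|I x y|; elim: n x y => // n IH x y; rewrite ltnS => In xy.
have [<-|nxy] := eqVneq x y; first exact: connect0.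
have [/existsP[z /andP[/andP[xz cxz] /andP[zy czy]]]|nz] :=
    boolP [exists z, strict (connect e) x z && strict (connect e) z y].
  apply: (@connect_trans _ _ z); apply: IH => //; apply: leq_trans In.
    apply: proper_card; apply/properP; split.
      apply/subsetP=> w; rewrite !inE => /andP[-> /connect_trans->//].
    exists y; rewrite !inE ?connect0 ?xy //.
    by apply: contra zy => /andP[_ yz]; apply/eqP/ea; rewrite czy.
  apply: proper_card; apply/properP; split.
    apply/subsetP=> w; rewrite !inE => /andP[zw ->].
    by rewrite (connect_trans cxz).
  exists x; rewrite !inE ?connect0 ?xy //.
  by apply: contra xz => /andP[zx _]; apply/eqP/ea; rewrite cxz.
apply: connect1; rewrite /is_succ /strict nxy xy nz !andbT /=.
have [z [exz xz czy]] := connect_first xy nxy.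
have [zy|zy] := eqVneq z y; first by rewrite -zy.
case/existsP: nz; exists z.
by rewrite /strict xz zy czy connect1.
Qed.

End Connect.

Section Colourings.

Variables (disp : Order.disp_t) (S : finOrderType disp) (W : wall S).
Local Notation A := (bidx W).
Implicit Types (phi psi : cmap W) (x y z : A).

Definition gstep : rel A := gen_step (@brick _ S W) (@brick_le _ S W) [set: A].

Definition adj : rel A := fun x y => brick x :&: brick y != set0.

Lemma adj_sym : symmetric adj.
Proof. by move=> x y; rewrite /adj setIC. Qed.

Lemma gstepP x y :
  reflect (exists s, [/\ s \in brick x, s \in brick y & brick_le s x y])
          (gstep x y).
Proof.
rewrite /gstep /gen_step !inE; apply: (iffP existsP) => -[s].
  by case/and3P; exists s.
by case=> *; exists s; apply/and3P.
Qed.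

Lemma adj_gstep x y : adj x y = gstep x y || gstep y x.
Proof.
apply/idP/idP => [/set0Pn[s /setIP[sx sy]]|].
  by case/orP: (brick_le_total sx sy) => le; apply/orP; [left|right];
    apply/gstepP; exists s.
by case/orP=> /gstepP[s [sx sy _]]; apply/set0Pn; exists s; rewrite inE ?sx ?sy.
Qed.

Lemma wall_le_refl : reflexive (@wall_le _ S W).
Proof. by move=> x; apply: connect0. Qed.

Lemma wall_le_anti : antisymmetric (@wall_le _ S W).
Proof. exact: gen_le_anti. Qed.

Lemma sub_le_anti (K : {set A}) : antisymmetric (sub_le K).
Proof.
move=> x y /andP[xy yx]; apply: wall_le_anti.
have sK : subrel (sub_le K) (@wall_le _ S W).
  apply: connect_mono => a b; rewrite /gen_step !inE => /and3P[_ _ ->] //.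
by rewrite !sK.
Qed.

(** Intersecting bricks are comparable in some order of a point, hence joined by a chain of covers;
    by [connect_succ] these covers can be taken to be generating steps, whose two ends intersect. *)
Lemma connected_bricksP (K : {set A}) :
  reflect {in K &, forall a b,
             connect (fun x y => [&& x \in K, y \in K & adj x y]) a b}
          (connected_bricks K).
Proof.
apply: (iffP forall_inP) => [H a b aK bK|H a aK].
  have /forall_inP/(_ b bK) := H a aK.
  by apply: connect_mono => x y /and4P[xK yK xy _]; apply/and3P.
apply/forall_inP=> b bK; apply: connect_sub (H a b aK bK) => x y /and3P[xK yK].
set f := fun _ _ => _.
have fE u v : sub_le K u v -> connect f u v && connect f v u.
  move/(connect_succ (@sub_le_anti K))=> uv.
  have fs p q : gen_step (@brick _ S W) (@brick_le _ S W) K p q &&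
     is_succ (connect (gen_step (@brick _ S W) (@brick_le _ S W) K)) p q ->
     f p q && f q p.
    case/andP=> /and3P[pK qK /existsP[s /and3P[sp sq _]]] pq.
    rewrite /f pK qK /sub_le /gen_le pq !orbT !andbT /=.
    by apply/andP; split; apply/set0Pn; exists s; rewrite !inE sp sq.
  move: u v uv; apply: connect_ind => [u|u v w /fs/andP[uv vu] _ /andP[vw wv]].
    by rewrite connect0.
  by rewrite (connect_trans (connect1 uv) vw) (connect_trans wv (connect1 vu)).
have gK u v : u \in K -> v \in K -> gstep u v -> sub_le K u v.
  move=> uK vK; rewrite /gstep /gen_step !inE => uv; apply: connect1.
  by rewrite /gen_step uK vK.
by rewrite adj_gstep => /orP[/(gK _ _ xK yK)/fE/andP[]|/(gK _ _ yK xK)/fE/andP[]].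
Qed.

(* The order of the colours, read on the bricks. *)
Definition qle phi : rel A := connect (fun x y => gstep x y || (phi x == phi y)).

Definition kern phi : {set A * A} := [set p | phi p.1 == phi p.2].

Lemma kernP phi psi :
  reflect (forall x y, (phi x == phi y) = (psi x == psi y)) (kern phi == kern psi).
Proof.
apply: (iffP eqP) => [/setP e x y|e].
  by have := e (x, y); rewrite !inE.
by apply/setP=> -[x y]; rewrite !inE.
Qed.

Lemma qle_refl phi x : qle phi x x. Proof. exact: connect0. Qed.

Lemma qle_trans phi : transitive (qle phi).
Proof. exact: connect_trans. Qed.

Lemma qle1 phi x y : gstep x y || (phi x == phi y) -> qle phi x y.
Proof. by move=> xy; apply: connect1. Qed.

Lemma qle_gstep phi x y : gstep x y -> qle phi x y.
Proof. by move=> xy; apply: connect1; rewrite xy. Qed.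

Lemma qle_eq phi x y : phi x = phi y -> qle phi x y.
Proof. by move=> xy; apply: connect1; rewrite xy eqxx orbT. Qed.

Lemma qle_wall phi x y : wall_le x y -> qle phi x y.
Proof. by apply: connect_mono => a b; rewrite /gstep => ->. Qed.

Lemma qle_sub phi psi : (forall x y, phi x = phi y -> psi x = psi y) ->
  subrel (qle phi) (qle psi).
Proof.
move=> s; apply: connect_mono => x y /orP[->//|/eqP/s->].
by rewrite eqxx orbT.
Qed.

Lemma eq_qle phi psi : kern phi = kern psi -> qle phi =2 qle psi.
Proof.
by move/eqP/kernP=> e; apply: eq_connect => x y; rewrite e.
Qed.

Lemma col_leE phi x y : col_le phi (phi x) (phi y) = qle phi x y.
Proof.
apply/idP/idP.
  have H c d : col_le phi c d -> forall x y, phi x = c -> phi y = d -> qle phi x y.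
    move: c d; apply: connect_ind => [c a b <- /esym|]; first exact: qle_eq.
    move=> c d e /exists_inP[k1 + /exists_inP[k2 + k12]].
    rewrite !inE => /eqP k1c /eqP k2d _ IH a b ac be.
    apply: (@qle_trans _ k1); first by apply: qle_eq; rewrite ac.
    by apply: (@qle_trans _ k2); [apply: qle_wall | apply: IH].
  by move/H; apply.
move: x y; apply: connect_ind => [x|x y z + _]; first exact: connect0.
case/orP=> [xy|/eqP->//]; apply: connect_trans; apply: connect1.
apply/exists_inP; exists x; rewrite ?inE //.
by apply/exists_inP; exists y; rewrite ?inE //; apply: connect1.
Qed.

Lemma col_le_colours phi c d : col_le phi c d -> c != d ->
  (c \in colours phi) && (d \in colours phi).
Proof.
move=> cd ncd.
have [e [/exists_inP[k1 + /exists_inP[k2 + _]] _ _]] := connect_first cd ncd.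
have [e' [/exists_inP[k3 + /exists_inP[k4 + _]] _ _]] := connect_last cd ncd.
rewrite !inE => _ /eqP<- /eqP<- _.
by rewrite !imset_f.
Qed.

Lemma is_colouringP phi :
  reflect ((forall x y, qle phi x y -> qle phi y x -> phi x = phi y) /\
           (forall x y, phi x = phi y ->
              connect (fun a b => [&& phi a == phi x, phi b == phi x & adj a b]) x y))
    (is_colouring phi).
Proof.
apply: (iffP andP) => -[H1 H2]; split.
- move=> x y xy yx; apply/eqP.
  by have /forallP/(_ (phi x))/forallP/(_ (phi y)) := H1; rewrite !col_leE xy yx.
- move=> x y xy.
  have /forall_inP/(_ (phi x) (imset_f _ _)) := H2.
  move/(_ isT)/connected_bricksP/(_ x y); rewrite !inE xy !eqxx => /(_ isT isT).
  by apply: connect_mono => a b; rewrite !inE.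
- apply/forallP=> c; apply/forallP=> d; apply/implyP=> /andP[cd dc].
  apply: contraT => ncd.
  have /andP[/imsetP[x _ cE] /imsetP[y _ dE]] := col_le_colours cd ncd.
  by move: cd dc ncd; rewrite cE dE !col_leE => xy /(H1 _ _ xy) ->; rewrite eqxx.
- apply/forall_inP=> _ /imsetP[x0 _ ->]; apply/connected_bricksP=> x y.
  rewrite !inE => /eqP xx0 /eqP yx0.
  have := H2 x y; rewrite xx0 yx0 => /(_ erefl).
  by apply: connect_mono => a b; rewrite !inE.
Qed.

Lemma eq_is_colouring phi psi : kern phi = kern psi ->
  is_colouring phi -> is_colouring psi.
Proof.
move=> e /is_colouringP[H1 H2]; apply/is_colouringP.
have /kernP k : kern phi == kern psi by apply/eqP.
split=> [x y|x y /eqP].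
  by rewrite -!(eq_qle e) => xy /(H1 _ _ xy)/eqP; rewrite k => /eqP.
by rewrite -k => /eqP/H2; apply: connect_mono => a b; rewrite !k.
Qed.

Lemma col_succP phi x y :
  reflect [/\ phi x <> phi y, qle phi x y &
             forall z, qle phi x z -> qle phi z y -> phi z = phi x \/ phi z = phi y]
          (col_succ phi (phi x) (phi y)).
Proof.
rewrite /col_succ /is_succ /strict col_leE.
apply: (iffP andP) => [[/andP[/eqP ne xy] nz]|[/eqP ne xy H]].
  split=> // z xz zy.
  have [->|nxz] := eqVneq (phi z) (phi x); first by left.
  have [->|nzy] := eqVneq (phi z) (phi y); first by right.
  by case/existsP: nz; exists (phi z); rewrite !col_leE xz zy nzy eq_sym nxz.
rewrite ne xy; split=> //; apply/existsPn=> c.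
apply/negP=> /andP[/andP[nxc xc] /andP[ncy cy]].
have /andP[_ /imsetP[z _ cE]] := col_le_colours xc nxc.
move: nxc xc ncy cy; rewrite cE !col_leE eq_sym => nxz xz nzy zy.
by case: (H z xz zy) => e; [rewrite e eqxx in nxz | rewrite e eqxx in nzy].
Qed.

Lemma col_succ_colours phi c d : col_succ phi c d ->
  exists x y, c = phi x /\ d = phi y.
Proof.
case/andP=> /andP[ncd cd] _.
have /andP[/imsetP[x _ ->] /imsetP[y _ ->]] := col_le_colours cd ncd.
by exists x, y.
Qed.

Lemma eq_col_succ phi psi x y : kern phi = kern psi ->
  col_succ phi (phi x) (phi y) = col_succ psi (psi x) (psi y).
Proof.
have H f g : kern f = kern g -> col_succ f (f x) (f y) -> col_succ g (g x) (g y).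
  move=> e; have /kernP k : kern f == kern g by apply/eqP.
  case/col_succP=> ne xy H; apply/col_succP; split=> [/eqP||z].
  - by rewrite -k => /eqP.
  - by rewrite -(eq_qle e).
  rewrite -!(eq_qle e) => xz zy.
  by case: (H z xz zy) => /eqP; rewrite k => /eqP ->; [left|right].
by move=> e; apply/idP/idP; apply: H.
Qed.

(** An isomorphism has to send [phi a] to [psi a], which is well defined and injective exactly when
    the partitions agree; the orders then match because both are read off [qle]. *)
Lemma col_isoE phi psi : col_iso phi psi = (kern phi == kern psi).
Proof.
apply/existsP/idP => [[F /and4P[/dinjectiveP Fi _ _ /forallP FE]]|].
  apply/kernP=> x y; rewrite -(eqP (FE x)) -(eqP (FE y)).
  by apply/eqP/eqP => [->//|/Fi]; apply; apply: imset_f.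
move=> e; have /kernP k := e; move/eqP in e.
pose F := [ffun c => if [pick a | phi a == c] is Some a then psi a else c].
have FE a : F (phi a) = psi a.
  rewrite ffunE; case: pickP => [b|/(_ a)]; last by rewrite eqxx.
  by rewrite k => /eqP.
exists F; apply/and4P; split.
- apply/dinjectiveP => _ _ /imsetP[x _ ->] /imsetP[y _ ->]; rewrite !FE => /eqP.
  by rewrite -k => /eqP.
- apply/eqP/setP=> c; apply/imsetP/imsetP => [[_ /imsetP[x _ ->] ->]|[x _ ->]].
    by exists x => //; rewrite FE.
  by exists (phi x); rewrite ?imset_f ?FE.
- apply/forall_inP=> _ /imsetP[x _ ->]; apply/forall_inP=> _ /imsetP[y _ ->].
  by rewrite !FE !col_leE (eq_qle e).
- by apply/forallP=> a; rewrite FE.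
Qed.

Lemma card_colours_kern phi psi : kern phi = kern psi ->
  #|colours phi| = #|colours psi|.
Proof.
move/eqP; rewrite -col_isoE => /existsP[F /and4P[/dinjectiveP Fi /eqP <- _ _]].
by rewrite card_in_imset.
Qed.

Lemma col_mergeE phi (x y a b : A) :
  (col_merge phi (phi x) (phi y) a == col_merge phi (phi x) (phi y) b)
  = [|| phi a == phi b, (phi a == phi x) && (phi b == phi y)
      | (phi a == phi y) && (phi b == phi x)].
Proof.
rewrite !ffunE; case: (eqVneq (phi a) (phi y)) => [->|nay];
  case: (eqVneq (phi b) (phi y)) => [->|nby]; rewrite ?eqxx ?andbT ?andbF ?orbF //=.
by rewrite (negPf nay).
Qed.

(** * Merging two successive colours *)

Section Merge.

Variables (phi : cmap W) (x y : A).
Hypotheses (phiC : is_colouring phi) (xy : col_succ phi (phi x) (phi y)).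
Let psi := col_merge phi (phi x) (phi y).

(** The only new passage is from the block of [y] back to that of [x]. A path using it several times
    can be shortened to its first arrival at [y] and its last departure from [x]. *)
Lemma qle_merge a b : qle psi a b = qle phi a b || qle phi a y && qle phi x b.
Proof.
have [_ xley _] := col_succP _ _ _ xy.
have sub c d : phi c = phi d -> psi c = psi d.
  by move=> e; apply/eqP; rewrite /psi col_mergeE e eqxx.
have pyx : psi y = psi x by apply/eqP; rewrite /psi col_mergeE !eqxx !orbT.
apply/idP/idP; last first.
  case/orP=> [|/andP[ay xb]]; first exact: qle_sub.
  apply: (@qle_trans _ y); first exact: qle_sub ay.
  by apply: (@qle_trans _ x); [apply: qle_eq | apply: qle_sub xb].
move: a b; apply: connect_ind => [a|a b c ab _ IH]; first by rewrite qle_refl.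
have : qle phi a b || qle phi a y && qle phi x b.
  case/orP: ab => [ab|]; first by rewrite qle_gstep.
  rewrite /psi col_mergeE => /or3P[/eqP e|/andP[/eqP e1 /eqP e2]|/andP[/eqP e1 /eqP e2]].
  - by rewrite qle_eq.
  - by rewrite (qle_trans (qle_eq e1) (qle_trans xley (qle_eq (esym e2)))).
  - by rewrite (qle_eq e1) (qle_eq (esym e2)) orbT.
case/orP: IH => [bc|/andP[by_ xc]] /orP[ab'|/andP[ay xb]].
- by rewrite (qle_trans ab' bc).
- by rewrite ay (qle_trans xb bc) orbT.
- by rewrite xc (qle_trans ab' by_) orbT.
- by rewrite ay xc orbT.
Qed.

(** No cycle appears because no colour lies strictly between the two merged ones, and the new block
    is connected because some brick of one meets some brick of the other. *)
Lemma is_colouring_merge : is_colouring psi.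
Proof.
have [nxy xley btw] := col_succP _ _ _ xy.
have [H1 H2] := is_colouringP _ phiC.
have sub c d : phi c = phi d -> psi c = psi d.
  by move=> e; apply/eqP; rewrite /psi col_mergeE e eqxx.
have pxy : psi x = psi y by apply/eqP; rewrite /psi col_mergeE !eqxx !orbT.
apply/is_colouringP; split=> [a b|].
  have key c : qle phi c y -> qle phi x c -> psi c = psi x.
    by move=> cy xc; case: (btw c xc cy) => /sub ->.
  rewrite !qle_merge => /orP[ab|/andP[ay xb]] /orP[ba|/andP[by_ xa]].
  - by apply/sub/H1.
  - by rewrite !key //; [apply: qle_trans xa ab | apply: qle_trans ab by_].
  - by rewrite !key //; [apply: qle_trans ba ay | apply: qle_trans xb ba].
  - by rewrite !key.
set f := fun c a b => [&& psi a == psi c, psi b == psi c & adj a b].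
have fsym c : connect_sym (f c).
  by apply: sym_connect_sym => a b; rewrite /f adj_sym andbCA.
have fc a b c : psi a = psi c -> phi a = phi b -> connect (f c) a b.
  move=> ac ab; apply: connect_mono (H2 a b ab) => d e /and3P[/eqP/sub da /eqP/sub ea].
  by rewrite /f da ea ac eqxx.
have fxy c : psi x = psi c -> connect (f c) x y.
  move=> xc.
  (* Along a path from [x] to [y] every brick lies in one of the two blocks, so the step that leaves
     the block of [x] enters that of [y]. *)
  have [x1 [y1 [x1x y1y x1y1]]] :
      exists x1 y1, [/\ phi x1 = phi x, phi y1 = phi y & gstep x1 y1].
    have H u v : qle phi u v -> qle phi x u -> phi u = phi x -> v = y ->
        exists x1 y1, [/\ phi x1 = phi x, phi y1 = phi y & gstep x1 y1].
      move: u v; apply: connect_ind => [u _ ux uy|u v w uv vw IH xu ux wy].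
        by case: nxy; rewrite -ux uy.
      rewrite wy in vw.
      case/orP: uv => [uv|/eqP uv]; last first.
        by apply: IH; rewrite // -?uv //; apply: qle_eq; rewrite -uv.
      have xv := qle_trans xu (qle_gstep phi uv).
      case: (btw v xv vw) => e; first exact: IH.
      by exists u, v.
    exact: (H x y xley (qle_refl _ _)).
  apply: (@connect_trans _ _ x1); first exact: fc.
  apply: (@connect_trans _ _ y1); last first.
    by apply: fc => //; rewrite -xc pxy; apply: sub.
  apply: connect1; rewrite /f (sub _ _ x1x) (sub _ _ y1y) -pxy xc eqxx.
  by rewrite adj_gstep x1y1.
move=> a b; move=> ab; change (connect (f a) a b).
have := introT eqP ab; rewrite /psi col_mergeE.
case/or3P=> [/eqP|/andP[/eqP ax /eqP yb]|/andP[/eqP ay /eqP xb]]; first exact: fc.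
- apply: (connect_trans (fc a x a _ ax)) => //.
  apply: (connect_trans (fxy a _)); first by rewrite (sub _ _ ax).
  by apply: fc => //; rewrite -pxy (sub _ _ ax).
- apply: (connect_trans (fc a y a _ ay)) => //.
  apply: (@connect_trans _ _ x).
    by rewrite fsym; apply: fxy; rewrite pxy (sub _ _ ay).
  by apply: fc => //; rewrite pxy (sub _ _ ay).
Qed.

Lemma colours_merge : colours psi = colours phi :\ phi y.
Proof.
have [nxy _ _] := col_succP _ _ _ xy.
apply/setP=> c; rewrite in_setD1; apply/imsetP/andP => [[a _ ->]|[ncy /imsetP[a _ cE]]].
  rewrite ffunE; case: (eqVneq (phi a) (phi y)) => [_|->]; rewrite ?imset_f //.
  by split=> //; apply/eqP.
by exists a => //; rewrite ffunE -cE (negPf ncy).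
Qed.

Lemma card_colours_merge : #|colours phi| = #|colours psi|.+1.
Proof. by rewrite colours_merge (cardsD1 (phi y) (colours phi)) imset_f. Qed.

End Merge.

End Colourings.

(** * The matching on colourings *)

Section Matching.

Variables (disp : Order.disp_t) (S : finOrderType disp) (W : wall S).
Local Notation A := (bidx W).
Implicit Types (phi psi gamma : cmap W) (x y z : A).

Variables (m b : A).
Hypothesis m_max : forall x, gstep m x -> x = m.
Hypothesis b_neq_m : b != m.
Hypothesis b_le_m : wall_le b m.

Definition link phi : rel A :=
  fun x y => [&& adj x y, phi x == phi y, x != m & y != m].

(** Components are named by canonical roots, so that equal partitions have literally equal
    invariants; [m] is linked to no brick and forms a class of its own. *)
Definition gam phi : cmap W := [ffun x => fingraph.root (link phi) x].

Lemma link_sym phi : connect_sym (link phi).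
Proof.
apply: sym_connect_sym => x y.
by rewrite /link adj_sym eq_sym [(y != m) && _]andbC.
Qed.

Lemma gamE phi x y : (gam phi x == gam phi y) = connect (link phi) x y.
Proof. by rewrite !ffunE root_connect //; apply: link_sym. Qed.

Lemma gam_sub phi x y : gam phi x = gam phi y -> phi x = phi y.
Proof.
move/eqP; rewrite gamE; move: x y; apply: connect_ind => // x y z.
by case/and4P=> _ /eqP -> _ _ _.
Qed.

Lemma gam_m phi x : gam phi x = gam phi m -> x = m.
Proof.
move/eqP; rewrite gamE => c; apply/eqP; case: eqVneq => // xm.
have [z [/and4P[_ _ _ /eqP] //]] := connect_last c xm.
Qed.

Lemma gam_link phi x y : adj x y -> phi x = phi y -> x != m -> y != m ->
  gam phi x = gam phi y.
Proof.
move=> xy e xm ym; apply/eqP; rewrite gamE; apply: connect1.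
by rewrite /link xy e xm ym eqxx.
Qed.

Lemma eq_link_gam phi psi : link phi =2 link psi -> gam phi = gam psi.
Proof. by move=> e; apply/ffunP=> x; rewrite !ffunE (eq_root e). Qed.

Lemma eq_gam phi psi : kern phi = kern psi -> gam phi = gam psi.
Proof.
by move/eqP/kernP=> e; apply: eq_link_gam => x y; rewrite /link e.
Qed.

Lemma kern_gam_inj phi psi : kern (gam phi) = kern (gam psi) -> gam phi = gam psi.
Proof.
move/eqP/kernP=> e; apply/ffunP=> x; rewrite !ffunE /fingraph.root; congr odflt.
by apply: eq_pick => y; rewrite -!gamE e.
Qed.

Lemma kern_gam_sub phi psi : kern phi \subset kern psi ->
  kern (gam phi) \subset kern (gam psi).
Proof.
move=> /subsetP s; apply/subsetP=> -[x y]; rewrite !inE /= !gamE.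
apply: connect_mono => u v /and4P[uv e um vm].
rewrite /link uv um vm !andbT /=.
by have := s (u, v); rewrite !inE; apply.
Qed.

Lemma qle_m gamma x : (forall y, gamma y = gamma m -> y = m) ->
  qle gamma m x -> x = m.
Proof.
move=> gm mx.
have H u v : qle gamma u v -> u = m -> v = m.
  move: u v; apply: connect_ind => // u v w uv _ IH um; apply: IH.
  by move: uv; rewrite um => /orP[/m_max|/eqP/esym/gm].
exact: H mx erefl.
Qed.

Section Colouring.

Variable phi : cmap W.
Hypothesis phiC : is_colouring phi.

Lemma qle_gam x y : qle (gam phi) x y -> qle phi x y.
Proof. by apply: qle_sub => u v; apply: gam_sub. Qed.

(** A cycle stays in one block of [phi] and, if it is not trivial, avoids the maximal brick [m];
    each of its generating steps then joins two intersecting bricks of that block, which is a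
    link. *)
Lemma gam_anti x y :
  qle (gam phi) x y -> qle (gam phi) y x -> gam phi x = gam phi y.
Proof.
have [H1 _] := is_colouringP _ phiC.
move: x y; apply: connect_ind => // x z y xz zy IH yx.
have zx := qle_trans zy yx; rewrite -IH; last first.
  by apply: qle_trans yx (qle1 xz).
case/orP: (xz) => [xz'|/eqP//].
have [xm|xm] := eqVneq x m.
  by rewrite xm in xz'; rewrite xm (m_max xz').
have [zm|zm] := eqVneq z m.
  rewrite zm in zx; case/eqP: xm; apply: qle_m zx => w; exact: gam_m.
apply: gam_link => //; first by rewrite adj_gstep xz'.
by apply: H1; apply: qle_gam => //; apply: qle1.
Qed.

(** A block without [m] loses nothing when [m] is deleted, so it remains connected. *)
Lemma gam_other x y : phi x = phi y -> phi x <> phi m -> gam phi x = gam phi y.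
Proof.
have [_ H2] := is_colouringP _ phiC.
move=> xy xm; apply/eqP; rewrite gamE; apply: connect_mono (H2 _ _ xy) => u v.
case/and3P=> /eqP ux /eqP vx uv; rewrite /link uv ux vx eqxx /=.
by apply/andP; split; apply: contra_notN xm => /eqP <-.
Qed.

(** In the connected block of [m], every component left after deleting [m] contains a brick meeting
    [m], and maximality puts that brick below [m]. *)
Lemma gam_below x : phi x = phi m -> qle (gam phi) x m.
Proof.
have [_ H2] := is_colouringP _ phiC.
move=> xm; have := H2 _ _ xm; set e := (fun _ _ => _) => c.
have H u v : connect e u v -> v = m -> qle (gam phi) u m.
  move: u v; apply: connect_ind => [u ->|u v w]; first exact: qle_refl.
  case/and3P=> /eqP ux /eqP vx uv _ IH /IH vm.
  have [->|um] := eqVneq u m; first exact: qle_refl.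
  have [E|nvm] := eqVneq v m; last first.
    by apply: qle_trans vm; apply/qle_eq/gam_link; rewrite ?ux.
  move: uv; rewrite E adj_gstep => /orP[/qle_gstep //|/m_max E'].
  by rewrite E' eqxx in um.
exact: H c erefl.
Qed.

(** Only the block of [m] is cut by [gam], and a path ending outside its upper set never visits
    it. *)
Lemma qle_gam1 x y : qle phi x y -> ~~ qle phi m y -> qle (gam phi) x y.
Proof.
move: x y; apply: connect_ind => [x _|x y z xy yz IH nmz]; first exact: qle_refl.
apply: qle_trans (IH nmz).
case/orP: xy => [/qle_gstep //|/eqP xy]; apply/qle_eq/gam_other => // xm.
by case/negP: nmz; apply: qle_trans yz; apply: qle_eq; rewrite -xm.
Qed.

Lemma qle_gam2 x : qle phi x m -> qle (gam phi) x m.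
Proof.
move=> xm; have H u v : qle phi u v -> v = m -> qle (gam phi) u m.
  move: u v; apply: connect_ind => [x' ->|u v w uv _ IH /IH vm]; first exact: qle_refl.
  have [um|/eqP um] := eqVneq (phi u) (phi m); first exact: gam_below.
  case/orP: uv => [/qle_gstep uv|/eqP uv]; first exact: qle_trans vm.
  by apply: qle_trans vm; apply/qle_eq/gam_other.
exact: H xm erefl.
Qed.

End Colouring.

Definition low_cover gamma t :=
  [&& t != m, qle gamma t m &
    [forall x, qle gamma t x && qle gamma x m ==> (gamma x == gamma t) || (x == m)]].

(** The choice depends on the invariant alone, so all colourings sharing an invariant share the
    pivot. [pivotP] excludes the default [m]. *)
Definition pivot gamma : A := odflt m [pick t | low_cover gamma t].

Lemma pivotP phi : is_colouring phi -> low_cover (gam phi) (pivot (gam phi)).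
Proof.
move=> phiC; rewrite /pivot; case: pickP => //= none.
pose P t := (t != m) && qle (gam phi) t m.
pose I t := [set x | [&& x != m, qle (gam phi) t x & qle (gam phi) x m]].
have Pb : P b by rewrite /P b_neq_m qle_wall.
(* A brick below [m] with the fewest bricks between it and [m] represents a lower cover; [b] shows
   that there are candidates. *)
case: (arg_minnP (fun t => #|I t|) Pb) => t /andP[tm tlem] tmin.
case/negP: (none t); rewrite /low_cover tm tlem /=.
apply/forallP=> x; apply/implyP=> /andP[tx xm].
have [//|nxm] := eqVneq x m; first by rewrite orbT.
have sub : I x \subset I t.
  by apply/subsetP=> w; rewrite !inE => /and3P[-> /(qle_trans tx) -> ->].
have : t \in I x.
  have /eqP -> : I x == I t by rewrite eqEcard sub tmin // /P nxm.
  by rewrite !inE tm qle_refl.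
by rewrite inE orbF => /and3P[_ xt _]; apply/eqP/gam_anti.
Qed.

Definition up phi := phi (pivot (gam phi)) != phi m.

Lemma eq_up phi psi : kern phi = kern psi -> up phi = up psi.
Proof.
by move=> e; rewrite /up (eq_gam e); move/eqP/kernP: e => ->.
Qed.

Definition match_merge phi :=
  col_merge phi (phi (pivot (gam phi))) (phi m).

Lemma eq_match_merge phi psi : kern phi = kern psi ->
  kern (match_merge phi) = kern (match_merge psi).
Proof.
move=> e; apply/eqP/kernP=> x y; rewrite !col_mergeE (eq_gam e).
by move/eqP/kernP: e => e; rewrite !e.
Qed.

Section Up.

Variable phi : cmap W.
Hypotheses (phiC : is_colouring phi) (phiU : up phi).
Let t := pivot (gam phi).

(** Below [m] and outside its upper set the orders of [phi] and [gam phi] agree, so a cover of the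
    invariant remains a cover of the colouring. *)
Lemma up_succ : col_succ phi (phi t) (phi m).
Proof.
have [H1 _] := is_colouringP _ phiC.
have /and3P[tm tlem /forallP tmin] := pivotP phiC.
apply/col_succP; split=> [||z tz zm]; first exact/eqP.
  exact: qle_gam.
have [mz|nmz] := boolP (qle phi m z); first by right; apply: H1.
have := tmin z; rewrite qle_gam1 ?qle_gam2 //= => /orP[/eqP/gam_sub|/eqP] ->.
  by left.
by right.
Qed.

(** The block of the pivot avoids [m], so it is a single class of the invariant; cutting that class
    off the merged block recovers [phi]. *)
Lemma kern_up x y :
  (phi x == phi y) = (match_merge phi x == match_merge phi y)
     && ((gam phi x == gam phi t) == (gam phi y == gam phi t)).
Proof.
have gt z : (gam phi z == gam phi t) = (phi z == phi t).
  apply/eqP/eqP => [/gam_sub //|e]; apply: gam_other => //.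
  by rewrite e; apply/eqP.
rewrite !gt col_mergeE -/t.
have [xy|xy] := eqVneq (phi x) (phi y); first by rewrite xy eqxx.
rewrite /=; apply/esym/negbTE; move: phiU; rewrite /up -/t => tm; rewrite negb_and negb_or.
have [xt|xt] := eqVneq (phi x) (phi t); have [yt|yt] := eqVneq (phi y) (phi t);
  rewrite /= ?orbT ?andbT ?andbF //.
by rewrite xt yt eqxx in xy.
Qed.

(** Merging creates no link: a brick of the block of [m] meeting one of the pivot's block is either
    above it, hence equal to [m] by the covering property, or below it, which would close a
    cycle. *)
Lemma gam_match_merge : gam (match_merge phi) = gam phi.
Proof.
have [H1 _] := is_colouringP _ phiC.
have /and3P[tm tlem /forallP tmin] := pivotP phiC.
apply: eq_link_gam => x y; rewrite /link col_mergeE -/t.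
have [xy|//] := boolP (adj x y); have [//|ne] := eqVneq (phi x) (phi y).
rewrite /=; apply: contraNF ne => /andP[+ /andP[xm ym]].
have key u v : gstep u v || gstep v u -> phi u = phi t -> phi v = phi m -> v = m.
  case/orP=> [uv|vu] ut vm.
    have gut : gam phi u = gam phi t.
      by apply: gam_other => //; rewrite ut; apply/eqP.
    have tv : qle (gam phi) t v.
      by apply: qle_trans (qle_gstep _ uv); apply: qle_eq.
    have := tmin v; rewrite tv gam_below //= => /orP[/eqP/gam_sub vt|/eqP//].
    by case/eqP: phiU; rewrite -/t -vt.
  case/eqP: phiU; rewrite -/t; apply: H1; first exact: qle_gam.
  apply: (@qle_trans _ _ _ _ v); first by apply: qle_eq.
  by apply: (@qle_trans _ _ _ _ u); [apply: qle_gstep | apply: qle_eq].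
rewrite adj_gstep in xy.
case/orP=> /andP[/eqP xt /eqP yt].
  by rewrite (key x y) ?eqxx // in ym.
by rewrite orbC in xy; rewrite (key y x) ?eqxx // in xm.
Qed.

Lemma match_merge_low : ~~ up (match_merge phi).
Proof.
rewrite negbK gam_match_merge -/t; apply/eqP; rewrite !ffunE eqxx.
by case: ifP.
Qed.

(** Being low means that pivot and [m] share a colour. A merge identifies a single pair of colours,
    so here it must be theirs. *)
Lemma match_merge_unique c d : col_succ phi c d ->
    gam (col_merge phi c d) = gam phi -> ~~ up (col_merge phi c d) ->
  kern (col_merge phi c d) = kern (match_merge phi).
Proof.
move=> cd; have [x [y [-> ->]]] := col_succ_colours cd => {cd} ge.
rewrite /up ge negbK -/t col_mergeE.
move: (phiU); rewrite /up -/t => /negbTE -> /= H.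
apply/eqP/kernP=> u v; rewrite !col_mergeE -/t.
case/orP: H => /andP[/eqP -> /eqP ->] //.
by rewrite orbC orbA [in RHS]orbC; case: (phi u == phi v); rewrite ?orbT //= orbC.
Qed.

End Up.

Lemma kern_up_inj phi psi :
    is_colouring phi -> is_colouring psi -> up phi -> up psi ->
    gam phi = gam psi -> kern (match_merge phi) = kern (match_merge psi) ->
  kern phi = kern psi.
Proof.
move=> phiC psiC phiU psiU ge /eqP/kernP e; apply/eqP/kernP => x y.
by rewrite (kern_up phiC phiU) (kern_up psiC psiU) ge e.
Qed.

(** The inverse of the matching: the class of the pivot is cut off the block of [m], the other
    classes of that block staying with [m]. *)
Lemma low_split psi : is_colouring psi -> ~~ up psi ->
  exists phi, [/\ is_colouring phi, up phi, gam phi = gam psi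
                & kern (match_merge phi) = kern psi].
Proof.
move=> psiC; rewrite negbK; set g := gam psi; set t := pivot g => /eqP tm.
have [H1 H2] := is_colouringP _ psiC.
have /and3P[ntm tlem _] := pivotP psiC.
pose e x y := (psi x == psi y) && ((g x == g t) == (g y == g t)).
have eE : equivalence_rel e.
  by apply/equivalence_relP; split=> [x|x y /andP[/eqP xy /eqP gxy] z];
    rewrite /e ?eqxx // xy gxy.
pose phi : cmap W := [ffun x => fingraph.root e x].
have phiE x y : (phi x == phi y) = e x y by rewrite !ffunE root_equiv.
have gphi : gam phi = g.
  apply: eq_link_gam => x y; rewrite /link phiE.
  have [xy|//] := boolP (adj x y).
  have [->|xm] := eqVneq x m; first by rewrite /= !andbF.
  have [->|ym] := eqVneq y m; first by rewrite /= !andbF.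
  rewrite !andbT /= /e; have [pxy|//] := eqVneq (psi x) (psi y).
  by rewrite (gam_link xy pxy xm ym) eqxx.
have gm : (g m == g t) = false.
  by apply/negbTE; apply: contra ntm => /eqP/esym/gam_m/eqP.
have phiU : up phi by rewrite /up gphi -/t phiE /e eqxx gm andbF.
exists phi; split; [|exact: phiU|exact: gphi|]; last first.
  apply/eqP/kernP=> x y; rewrite col_mergeE gphi -/t !phiE /e tm gm eqxx.
  have [xm|xm] := eqVneq (psi x) (psi m); have [ym|ym] := eqVneq (psi y) (psi m);
    rewrite ?xm ?ym ?eqxx ?(eq_sym (psi m)) ?(negPf xm) ?(negPf ym) ?andbF ?orbF //=.
    by case: (g x == g t); case: (g y == g t).
  have [pxy|//] := eqVneq (psi x) (psi y).
  rewrite (gam_other psiC pxy) ?eqxx //; exact/eqP.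
apply/is_colouringP; split=> [x y|].
  have sub u v : phi u = phi v -> psi u = psi v.
    by move/eqP; rewrite phiE => /andP[/eqP].
  move=> xy yx; have pxy := H1 _ _ (qle_sub sub xy) (qle_sub sub yx).
  (* A cycle cannot go from the rest of the block into the pivot's class: steps between bricks other
     than [m] are links and keep the class, and no step goes up from [m]. *)
  have key u v : qle phi u v -> qle phi v u -> psi u = psi m ->
      g u != g t -> g v != g t.
    move: u v; apply: connect_ind => // u v w uv vw IH wu um ut.
    have vu := qle_trans vw wu.
    have pvu : psi v = psi u.
      by apply: H1; apply: qle_sub sub _ _ _ => //; apply: qle1.
    apply: IH; [exact: qle_trans wu (qle1 uv)|by rewrite pvu|].
    case/orP: uv => [uv|]; last by rewrite phiE => /andP[_ /eqP <-].
    have [eum|num] := eqVneq u m.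
      by move: uv ut; rewrite eum => /m_max ->.
    have [->|nvm] := eqVneq v m; first by rewrite gm.
    by rewrite -(gam_link _ (esym pvu)) // adj_gstep uv.
  apply/eqP; rewrite phiE /e pxy eqxx /=.
  have [ym|/eqP nym] := eqVneq (psi y) (psi m); last first.
    by rewrite (@gam_other _ psiC x y) ?pxy ?eqxx.
  have xm : psi x = psi m by rewrite pxy.
  have [gx|gx] := boolP (g x == g t); have [gy|gy] := boolP (g y == g t) => //.
    by have := key y x yx xy ym gy; rewrite gx.
  by have := key x y xy yx xm gx; rewrite gy.
move=> x y pxy; have := introT eqP pxy; rewrite phiE => /andP[/eqP qxy /eqP gxy].
set f := fun _ _ => _.
have fsym : connect_sym f.
  by apply: sym_connect_sym => u v; rewrite /f adj_sym andbCA.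
have fg u v : psi u = psi x -> (g u == g t) = (g x == g t) -> g u = g v ->
    connect f u v.
  move=> ux gx /eqP; rewrite gamE => c.
  have H p q : connect (link psi) p q -> g p = g u -> connect f p q.
    move: p q; apply: connect_ind => [p _|p q r pq _ IH gp]; first exact: connect0.
    have gq : g q = g u by rewrite -gp; apply/esym/eqP; rewrite gamE connect1.
    apply: connect_trans (IH gq); apply: connect1.
    by rewrite /f !phiE /e gp gq gx (gam_sub gp) (gam_sub gq) ux !eqxx; case/and4P: pq => ->.
  exact: H c erefl.
have [xm|/eqP nxm] := eqVneq (psi x) (psi m); last first.
  by apply: fg => //; apply: gam_other.
have [gx|gx] := boolP (g x == g t).
  by apply: fg => //; move: gxy; rewrite gx (eqP gx) => /esym/eqP.
(* The remaining piece contains [m], and each of its bricks reaches [m] without entering the pivot's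
   class, since bricks other than [m] that are consecutive on a path in the block are linked. *)
suff fm u : psi u = psi m -> g u != g t -> connect f u m.
  apply: (connect_trans (fm x xm gx)); rewrite fsym; apply: fm; first by rewrite -qxy.
  by rewrite -gxy.
move=> um; have := H2 _ _ um; set h := (fun _ _ => _) => c.
have H p q : connect h p q -> q = m -> g p != g t -> connect f p m.
  move: p q; apply: connect_ind => [p -> _|p q r]; first exact: connect0.
  case/and3P=> /eqP pu /eqP qu pq _ IH rm gp.
  have [->|pm] := eqVneq p m; first exact: connect0.
  have gq : g q != g t.
    have [->|qm] := eqVneq q m; first by rewrite gm.
    by rewrite -(gam_link pq) // pu.
  apply: connect_trans (IH rm gq); apply: connect1.
  rewrite /f !phiE /e pu qu um xm (negPf gp) (negPf gq) (negPf gx) !eqxx.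
  by rewrite pq.
exact: H c erefl.
Qed.

(** The number of pairs separated by the invariant. Merging can only coarsen the invariant, so equal
    rank before and after forces equal invariants. *)
Definition rank phi := #|~: kern (gam phi)|.

Lemma rank_merge phi x y : (rank (col_merge phi (phi x) (phi y)) <= rank phi)%N.
Proof.
apply: subset_leq_card; rewrite setCS; apply: kern_gam_sub.
by apply/subsetP=> -[u v]; rewrite !inE /= col_mergeE => ->.
Qed.

Lemma rank_merge_eq phi x y : rank (col_merge phi (phi x) (phi y)) = rank phi ->
  gam (col_merge phi (phi x) (phi y)) = gam phi.
Proof.
move=> e; apply: kern_gam_inj; apply/esym/eqP; rewrite eqEcard; apply/andP; split.
  apply: kern_gam_sub.
  by apply/subsetP=> -[u v]; rewrite !inE /= col_mergeE => ->.
have := cardsC (kern (gam phi)).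
by rewrite -(cardsC (kern (gam (col_merge phi (phi x) (phi y))))) -!/(rank _) e => /addIn ->.
Qed.

End Matching.

Local Open Scope ring_scope.

(** * Exactness *)

Section MatchingExact.

Variables (X Y Z : finType) (dX : X -> Y -> int) (dY : Y -> Z -> int).
Variables (r : Y -> nat) (up : pred Y).

Hypothesis dXdY : forall x z, \sum_y dX x y * dY y z = 0.
Hypothesis partner_up : forall y, ~~ up y -> exists x, dX x y * dX x y = 1 /\
  forall y', ~~ up y' -> y' != y -> dX x y' != 0 -> (r y' < r y)%N.
Hypothesis partner_low : forall y, up y -> exists z, dY y z * dY y z = 1 /\
  forall y', up y' -> y' != y -> dY y' z != 0 -> (r y < r y')%N.

(** Gaussian elimination from the highest rank down: subtracting the partners of the low elements of
    top rank changes the other low coefficients only in smaller rank. *)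
Lemma low_part_bounding k (u : Y -> int) :
    (forall y, ~~ up y -> (k <= r y)%N -> u y = 0) ->
  exists v : X -> int, forall y, ~~ up y -> \sum_x v x * dX x y = u y.
Proof.
elim: k u => [|k IH] u u0.
  by exists (fun _ => 0) => y yL; rewrite u0 // big1 // => x _; rewrite mul0r.
pose good y x := ~~ up y -> dX x y * dX x y = 1 /\
  forall y', ~~ up y' -> y' != y -> dX x y' != 0 -> (r y' < r y)%N.
(* The pivot entry is its own inverse, so it serves as the coefficient that reproduces [u y] at
   [y]. *)
pose w (p : Y -> X) x := \sum_(y | ~~ up y && (r y == k)) u y * dX x y * (p y == x)%:R.
(* A low element provides an inhabitant of [X], the dummy partner of the up elements. *)
have [y0 y0L|none] := pickP (fun y => ~~ up y); last first.
  by exists (fun _ => 0) => y; rewrite none.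
have [x0 _] := partner_up y0L.
have ex y : exists x, good y x.
  have [yU|yL] := boolP (up y); first by exists x0 => yL; rewrite yU in yL.
  by have [x ?] := partner_up yL; exists x.
have [p pP] := fin_all_exists ex.
have wE y : \sum_x w p x * dX x y =
    \sum_(y' | ~~ up y' && (r y' == k)) u y' * dX (p y') y' * dX (p y') y.
  under eq_bigr => x _ do rewrite mulr_suml.
  rewrite exchange_big; apply: eq_bigr => y' _ /=.
  rewrite (bigD1 (p y')) //= eqxx mulr1 big1 ?addr0 // => x xp.
  by rewrite eq_sym (negPf xp) mulr0 mul0r.
have [|v vE] := IH (fun y => u y - \sum_x w p x * dX x y); last first.
  exists (fun x => v x + w p x) => y yL.
  under eq_bigr => x _ do rewrite mulrDl.
  by rewrite big_split /= vE // subrK.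
move=> y yL; rewrite leq_eqVlt wE => /orP[/eqP ky|ky].
  rewrite (bigD1 y) ?yL -?ky ?eqxx //= -mulrA (pP y yL).1 mulr1 big1 ?addr0 ?subrr //.
  move=> y' /andP[/andP[y'L /eqP y'k] ne]; apply/eqP; rewrite mulf_eq0; apply/orP; right.
  apply: contraT => ne0; have := (pP y' y'L).2 y yL.
  by rewrite eq_sym ne ne0 y'k -ky ltnn => /(_ isT isT).
rewrite u0 // big1 ?subr0 // => y' /andP[y'L /eqP y'k].
apply/eqP; rewrite mulf_eq0; apply/orP; right.
apply: contraT => ne0; have := (pP y' y'L).2 y yL.
have -> : y != y' by apply: contraTneq ky => ->; rewrite y'k ltnn.
by rewrite ne0 y'k ltnNge ltnW // => /(_ isT isT).
Qed.

(** Descending induction on the rank: in the boundary coefficient at the partner of [y], the other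
    up elements have larger rank and already vanish. *)
Lemma up_cycle_eq0 (u : Y -> int) :
    (forall y, ~~ up y -> u y = 0) ->
    (forall z, \sum_y u y * dY y z = 0) ->
  forall y, u y = 0.
Proof.
move=> uL uZ y.
pose N := (\max_y r y)%N.
have [k] := ubnP (N - r y)%N; elim: k y => // k IH y; rewrite ltnS => yk.
have [yU|/uL//] := boolP (up y).
have [z [zy zmin]] := partner_low yU.
have := uZ z; rewrite (bigD1 y) //= big1 ?addr0.
  by move/(congr1 (fun t => t * dY y z)); rewrite mul0r -mulrA zy mulr1.
move=> y' y'y; have [y'U|/uL ->] := boolP (up y'); last by rewrite mul0r.
have [->|ne0] := eqVneq (dY y' z) 0; first by rewrite mulr0.
rewrite IH ?mul0r //; apply: leq_trans yk.
have rlt := zmin y' y'U y'y ne0.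
by rewrite ltn_sub2l // (leq_trans rlt) // /N leq_bigmax.
Qed.

Lemma matching_exact (u : Y -> int) :
    (forall z, \sum_y u y * dY y z = 0) ->
  exists v : X -> int, forall y, \sum_x v x * dX x y = u y.
Proof.
move=> uZ; have [|v vE] := @low_part_bounding (\max_y r y).+1 u.
  by move=> y _; rewrite ltnNge leq_bigmax.
exists v => y; apply/eqP; rewrite -subr_eq0; apply/eqP; move: y.
apply: up_cycle_eq0 => [y yL|z]; first by rewrite vE // subrr.
under eq_bigr => y _ do rewrite mulrBl.
rewrite big_split /= sumrN uZ subr0.
under eq_bigr => y _ do rewrite mulr_suml.
rewrite exchange_big big1 // => x _.
under eq_bigr => y _ do rewrite -mulrA.
by rewrite -mulr_sumr dXdY mulr0.
Qed.

End MatchingExact.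

(** * The incidence matrix of classes of colourings *)

Section Acyclic.

Variables (disp : Order.disp_t) (S : finOrderType disp) (W : wall S).
Local Notation A := (bidx W).
Implicit Types (phi psi : cmap W).

Lemma ColP n (X : {set cmap W}) :
  reflect (exists phi, [/\ is_colouring phi, #|colours phi| = n
                         & X = [set psi | kern psi == kern phi]])
          (X \in Col W n).
Proof.
have E phi : is_colouring phi -> #|colours phi| = n ->
    [set psi in [set phi | is_colouring phi && (#|colours phi| == n)] | col_iso phi psi]
    = [set psi | kern psi == kern phi].
  move=> phiC phin; apply/setP=> psi; rewrite !inE col_isoE [RHS]eq_sym.
  have [e|_] := eqVneq (kern phi) (kern psi); last by rewrite andbF.
  by rewrite (eq_is_colouring e phiC) -(card_colours_kern e) phin eqxx.
apply: (iffP imsetP) => [[phi]|[phi [phiC phin ->]]].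
  by rewrite inE => /andP[phiC /eqP phin] ->; exists phi; rewrite E.
by exists phi; rewrite ?E // inE phiC phin eqxx.
Qed.

Section Class.

Variables (n : nat) (X : {X | X \in Col W n}).

Lemma col_reprP : [/\ is_colouring (col_repr X), #|colours (col_repr X)| = n
  & val X = [set psi | kern psi == kern (col_repr X)]].
Proof.
have /ColP[phi [phiC phin XE]] := valP X.
have : col_repr X \in val X.
  rewrite /col_repr; case: pickP => //= /(_ phi).
  by rewrite XE inE eqxx.
rewrite {1}XE inE => /eqP e.
split; first exact: eq_is_colouring (esym e) phiC.
  by rewrite (card_colours_kern e).
by rewrite e.
Qed.

Lemma col_repr_colouring : is_colouring (col_repr X).
Proof. by have [] := col_reprP. Qed.

Lemma card_colours_repr : #|colours (col_repr X)| = n.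
Proof. by have [] := col_reprP. Qed.

Lemma mem_class psi : (psi \in val X) = (kern psi == kern (col_repr X)).
Proof. by have [_ _ ->] := col_reprP; rewrite inE. Qed.

End Class.

Lemma col_repr_inj n (X Y : {X | X \in Col W n}) :
  kern (col_repr X) = kern (col_repr Y) -> X = Y.
Proof.
by move=> e; apply/val_inj/setP=> psi; rewrite !mem_class e.
Qed.

Lemma class_exists n phi : is_colouring phi -> #|colours phi| = n ->
  exists X : {X | X \in Col W n}, kern (col_repr X) = kern phi.
Proof.
move=> phiC phin.
have XC : [set psi | kern psi == kern phi] \in Col W n by apply/ColP; exists phi.
exists (exist (fun X => X \in Col W n) _ XC); apply/esym/eqP.
by rewrite -mem_class /= inE.
Qed.

Variable L : cmap W -> A -> A -> nat.

Definition incidence n (X : {X | X \in Col W n.+1}) (Y : {Y | Y \in Col W n}) : int :=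
  \sum_(p : A * A | col_succ (col_repr X) p.1 p.2)
    (col_merge (col_repr X) p.1 p.2 \in val Y)%:R * (-1) ^+ L (col_repr X) p.1 p.2.

Lemma ffunMzE (T : finType) (f : {ffun T -> int}) (k : int) x :
  (f *~ k) x = f x * k.
Proof.
by case: k => k; rewrite ?NegzE ?mulrNz ?ffunE -pmulrn ffunMnE -mulr_natr ?mulrN natz.
Qed.

Lemma col_bdryE n (u : col_chain W n.+1) Y :
  col_bdry L u Y = \sum_X u X * incidence X Y.
Proof.
rewrite /col_bdry sum_ffunE; apply: eq_bigr => X _.
rewrite sum_ffunE mulr_sumr; apply: eq_bigr => p _.
by rewrite ffunMzE ffunE mulrCA.
Qed.

Lemma incidence_neq0 n (X : {X | X \in Col W n.+1}) (Y : {Y | Y \in Col W n}) :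
  incidence X Y != 0 -> exists c d, col_succ (col_repr X) c d /\
    kern (col_merge (col_repr X) c d) = kern (col_repr Y).
Proof.
move=> ne0.
have [p /andP[ps pY]|none] := pickP (fun p : A * A => col_succ (col_repr X) p.1 p.2 &&
   (col_merge (col_repr X) p.1 p.2 \in val Y)).
  by exists p.1, p.2; split=> //; apply/eqP; rewrite -mem_class.
case/eqP: ne0; apply: big1 => p ps.
by have := none p; rewrite ps /= => ->; rewrite mul0r.
Qed.

(** A merge identifies one unordered pair of colours, and antisymmetry fixes which of the two is
    lower. So each incidence number has at most one non-zero term. *)
Lemma merge_unique phi c d c' d' : is_colouring phi ->
    col_succ phi c d -> col_succ phi c' d' ->
    kern (col_merge phi c d) = kern (col_merge phi c' d') ->
  c = c' /\ d = d'.
Proof.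
move=> phiC cd cd'.
have [x [y [cE dE]]] := col_succ_colours cd.
have [x' [y' [c'E d'E]]] := col_succ_colours cd'; subst.
move=> /eqP/kernP/(_ x y); rewrite !col_mergeE !eqxx orbT /=.
have [/eqP/negbTE -> xy _] := col_succP _ _ _ cd.
have [xy'n xy' _] := col_succP _ _ _ cd'.
move=> /=; move/esym/orP=> [/andP[/eqP -> /eqP ->] //|/andP[/eqP e1 /eqP e2]].
have [H _] := is_colouringP _ phiC.
case: xy'n; apply: H xy' _.
apply: qle_trans (qle_eq (esym e1)) _; exact: qle_trans xy (qle_eq e2).
Qed.

Lemma incidence_merge n (X : {X | X \in Col W n.+1}) (Y : {Y | Y \in Col W n}) c d :
    col_succ (col_repr X) c d ->
    kern (col_merge (col_repr X) c d) = kern (col_repr Y) ->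
  incidence X Y * incidence X Y = 1.
Proof.
move=> cd cdY; rewrite /incidence (bigD1 (c, d)) //= mem_class cdY eqxx mul1r.
rewrite big1 ?addr0; first by rewrite -expr2 sqrr_sign.
move=> [c' d'] /= /andP[cd' ne]; rewrite mem_class -cdY.
have [e|_] := eqVneq (kern _) (kern _); last by rewrite mul0r.
have [c'E d'E] := merge_unique (col_repr_colouring X) cd' cd e.
by rewrite c'E d'E eqxx in ne.
Qed.

Theorem complex_acyclic : (exists a b : A, is_succ (@wall_le _ _ W) a b) ->
  is_complex L -> acyclic L.
Proof.
move=> [a [b ab]] Lc n u; split=> [u0|[v <-]]; last exact: Lc.
have [m [m' [m_max m'm m'lem]]] : exists m m' : A,
    [/\ forall x, gstep m x -> x = m, m' != m & wall_le m' m].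
  pose P x := strict (@wall_le _ _ W) a x.
  have Pb : P b by case/andP: ab.
  (* Among the bricks strictly above [a], one with the fewest bricks above it is maximal; [a] is
     then the required brick below it. *)
  have [m /andP[am alem] mmax] :=
    arg_minnP (fun x => #|[set y | wall_le x y]|) Pb.
  exists m, a; split=> // x mx; apply: wall_le_anti.
  have mx' : wall_le m x by apply: connect1.
  rewrite mx' andbT.
  have Px : P x.
    have ax : wall_le a x := connect_trans alem mx'.
    rewrite /P /strict ax andbT; apply: contra am => /eqP e.
    by apply/eqP/wall_le_anti; rewrite alem e.
  have sub : [set y | wall_le x y] \subset [set y | wall_le m y].
    by apply/subsetP=> y; rewrite !inE; apply: connect_trans.
  have /eqP/setP/(_ m) : [set y | wall_le x y] == [set y | wall_le m y].
    by rewrite eqEcard sub mmax.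
  by rewrite !inE => ->; apply: connect0.
pose r (Y : {Y | Y \in Col W n.+1}) := rank m (col_repr Y).
pose U (Y : {Y | Y \in Col W n.+1}) := up m (col_repr Y).
have [|||z|v vE] := @matching_exact _ _ _ (@incidence n.+1) (@incidence n) r U _ _ _ u.
- move=> X Z; pose dX : col_chain W n.+2 := [ffun X' => (X' == X)%:R].
  have := congr1 (fun f : col_chain W n => f Z) (Lc _ dX).
  rewrite [RHS]ffunE col_bdryE => sum0; rewrite -[RHS]sum0.
  apply: eq_bigr => Y _; congr (_ * _).
  rewrite col_bdryE (bigD1 X) //= ffunE eqxx mul1r big1 ?addr0 // => X' ne.
  by rewrite ffunE (negPf ne) mul0r.
- move=> Y YL; have YC := col_repr_colouring Y.
  have [phi [phiC phiU ge me]] := low_split m_max m'm m'lem YC YL.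
  have ps := up_succ m_max m'm m'lem phiC phiU.
  have [|X XE] := @class_exists n.+2 phi phiC.
    by rewrite (card_colours_merge ps) (card_colours_kern me) card_colours_repr.
  have XU : up m (col_repr X) by rewrite (eq_up m XE).
  have XC := col_repr_colouring X.
  have Xme : kern (match_merge m (col_repr X)) = kern (col_repr Y).
    by rewrite (eq_match_merge m XE).
  exists X; split.
    by apply: incidence_merge (up_succ m_max m'm m'lem XC XU) Xme.
  move=> Y' Y'L ne /incidence_neq0[c [d [cd cdE]]]; rewrite ltnNge.
  (* If the rank did not drop, the merge kept the invariant, and its low result can only be the
     matched one. *)
  apply: contra ne => le; apply/eqP/col_repr_inj; rewrite -Xme -cdE.
  have [x [y [cE dE]]] := col_succ_colours cd; subst c d.
  have gXY : gam m (col_repr X) = gam m (col_repr Y) by rewrite (eq_gam m XE).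
  apply: match_merge_unique => //.
    apply: rank_merge_eq; apply/eqP; rewrite eqn_leq rank_merge /=.
    rewrite /r {1}/rank -gXY in le; apply: leq_trans le _.
    by rewrite /rank (eq_gam m cdE).
  by rewrite (eq_up m cdE).
- move=> Y YU; have YC := col_repr_colouring Y.
  have ps := up_succ m_max m'm m'lem YC YU.
  have [||Z ZE] := @class_exists n (match_merge m (col_repr Y)).
  - exact: is_colouring_merge.
  - by apply: succn_inj; rewrite -(card_colours_merge ps) card_colours_repr.
  exists Z; split; first exact: incidence_merge ps (esym ZE).
  move=> Y' Y'U ne /incidence_neq0[c [d [cd cdE]]]; rewrite ltnNge.
  (* Otherwise the merge from [Y'] kept the invariant, so [Y] and [Y'] share both invariant and
     partner, and [kern_up_inj] identifies them. *)
  apply: contra ne => le; apply/eqP/col_repr_inj.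
  have Y'C := col_repr_colouring Y'.
  have gZ : gam m (col_repr Z) = gam m (col_repr Y).
    by rewrite (eq_gam m ZE) (gam_match_merge m_max m'm m'lem YC YU).
  have [x [y [cE dE]]] := col_succ_colours cd; subst c d.
  have gm : gam m (col_merge (col_repr Y') (col_repr Y' x) (col_repr Y' y)) =
      gam m (col_repr Y').
    apply: rank_merge_eq; apply/eqP; rewrite eqn_leq rank_merge /=.
    by apply: leq_trans le _; rewrite /r /rank -gZ -(eq_gam m cdE).
  have ge : gam m (col_repr Y') = gam m (col_repr Y).
    by rewrite -gm (eq_gam m cdE).
  apply: (@kern_up_inj _ _ _ m _ _ Y'C YC Y'U YU ge).
  rewrite -ZE -cdE; apply/esym/match_merge_unique => //.
  rewrite (eq_up m cdE) (eq_up m ZE).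
  exact: (match_merge_low m_max m'm m'lem YC YU).
- by rewrite -col_bdryE u0 ffunE.
exists [ffun X => v X]; apply/ffunP=> Y; rewrite col_bdryE -vE.
by apply: eq_bigr => X _; rewrite ffunE.
Qed.

End Acyclic.

(** * The boundary with [Lambda_min] squares to zero *)

Section PosetMerge.

Variables (T : finType) (le : rel T).
Hypotheses (le_refl : reflexive le) (le_anti : antisymmetric le)
  (le_trans : transitive le).

(** The merged element keeps the name [c], and [d] becomes isolated, just as [col_le] is the
    identity outside the colours in use. *)
Definition merge_le (c d : T) : rel T := fun a b =>
  (a == b) || [&& a != d, b != d & le a b || le a d && le c b].

Lemma is_succP (r : rel T) a b :
  reflect [/\ a <> b, r a b & forall z, r a z -> r z b -> z = a \/ z = b]
          (is_succ r a b).
Proof.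
rewrite /is_succ /strict; apply: (iffP andP) => [[/andP[/eqP ab rab] nz]|[/eqP ab rab H]].
  split=> // z az zb.
  have [->|za] := eqVneq z a; first by left.
  have [->|zb'] := eqVneq z b; first by right.
  by case/existsP: nz; exists z; rewrite az zb zb' eq_sym za.
rewrite ab rab; split=> //; apply/existsPn=> z; apply/negP.
move=> /andP[/andP[az raz] /andP[zb rzb]].
by case: (H z raz rzb) => e; subst z; rewrite eqxx in az zb.
Qed.

Lemma merge_succP c d a b :
  reflect [/\ a <> b, a <> d /\ b <> d, le a b \/ le a d /\ le c b &
    forall z, z <> d -> le a z \/ le a d /\ le c z -> le z b \/ le z d /\ le c b ->
       z = a \/ z = b]
          (is_succ (merge_le c d) a b).
Proof.
apply: (iffP (is_succP _ _ _)) => [[ab + H]|[ab [ad bd] H1 H2]].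
  rewrite /merge_le => /orP[/eqP //|/and3P[/eqP ad /eqP bd H1]].
  split=> //; first by case/orP: H1 => [|/andP[]]; [left|right].
  move=> z zd az zb; apply: H; rewrite /merge_le; apply/orP; right.
    apply/and3P; split; [exact/eqP|exact/eqP|].
    by case: az => [->|[-> ->]]; rewrite ?orbT.
  apply/and3P; split; [exact/eqP|exact/eqP|].
  by case: zb => [->|[-> ->]]; rewrite ?orbT.
split=> //.
  rewrite /merge_le; apply/orP; right; apply/and3P; split; [exact/eqP|exact/eqP|].
  by case: H1 => [->|[-> ->]]; rewrite ?orbT.
move=> z; rewrite /merge_le.
move=> /orP[/eqP ->|/and3P[_ /eqP zd az]]; first by left.
move=> /orP[/eqP ->|/and3P[_ _ zb]]; first by right.
apply: H2 => //; first by case/orP: az => [|/andP[]]; [left|right].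
by case/orP: zb => [|/andP[]]; [left|right].
Qed.

(* The other way of merging the same colours in two steps. The result of      *)
(* merging (c, d) is called c, as in [col_merge].                             *)
Definition flip_merges (w : (T * T) * (T * T)) : (T * T) * (T * T) :=
  let: ((c, d), (a, b)) := w in
  if a == c then if le d b then ((d, b), (c, d)) else ((c, b), (c, d))
  else if b == c then if le a c then ((a, c), (a, d)) else ((a, d), (c, a))
  else ((a, b), (c, d)).

Definition two_merges (w : (T * T) * (T * T)) : bool :=
  is_succ le w.1.1 w.1.2 && is_succ (merge_le w.1.1 w.1.2) w.2.1 w.2.2.

(** Two merges collapse either two disjoint pairs, whose order is exchanged, or three elements
    forming a chain, a fork or a join, in which a different covering pair can be merged first. *)
Lemma flip_mergesP w : two_merges w ->
  two_merges (flip_merges w) && (flip_merges (flip_merges w) == w).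
Proof.
case: w => [[c d] [a b]] /andP[/is_succP[/= cd cled Cz] /merge_succP[ab [ad bd] M1 M2]].
have asym x y : le x y -> le y x -> x = y by move=> xy yx; apply: le_anti; rewrite xy.
rewrite /flip_merges.
have [E|/eqP ac] := eqVneq a c; first (subst a; have cleb : le c b by case: M1 => [|[]]).
  have [dleb|/negP ndleb] := boolP (le d b); rewrite /two_merges /=.
    rewrite (introF eqP cd) eqxx cled eqxx andbT.
    apply/andP; split; [apply/is_succP|apply/merge_succP]; split; auto.
      move=> z dz zb; have [->|/eqP zd] := eqVneq z d; first by left.
      have [| |zc|->] := M2 z zd; [by left; apply: le_trans dz|by left| |by right].
      by subst z; case: cd; apply: asym.
    move=> z zb cz zd; have [->|/eqP nzd] := eqVneq z d; first by right.
    have [| | |//] := M2 z nzd; [| |by left].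
      by left; case: cz => [//|[_]]; apply: le_trans.
    by left; case: zd => [zd|[]//]; apply: le_trans dleb.
  have nbd : le b d = false.
    by apply/negP => bled; case: (Cz b cleb bled) => // E; case: ab.
  rewrite !eqxx nbd eqxx andbT.
  apply/andP; split; [apply/is_succP|apply/merge_succP]; split; auto.
    move=> z cz zb; have [E|/eqP zd] := eqVneq z d; first by subst z.
    by apply: M2 => //; left.
  move=> z zb cz' zd.
  have cz : le c z by case: cz' => [|[]].
  case: zd => [zd|[zleb _]]; first exact: Cz.
  have [->|/eqP nzd] := eqVneq z d; first by right.
  by case: (M2 z nzd) => [|| |//]; [left|left|left].
have [E|/eqP bc] := eqVneq b c.
  subst b; have aled : le a d by case: M1 => [ac'|[]//]; apply: le_trans cled.
  have N z : z <> d -> le z d -> le a z \/ le c z -> z = a \/ z = c.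
    by move=> zd zled az; apply: M2 => //; [case: az; [left|right]|right].
  have [alec|/negP nalec] := boolP (le a c); rewrite /two_merges /=.
    rewrite !eqxx cled eqxx andbT.
    apply/andP; split; [apply/is_succP|apply/merge_succP]; split; auto.
      move=> z az zc; have [E|/eqP zd] := eqVneq z d.
        by subst z; case: cd; apply: asym.
      by apply: N => //; [apply: le_trans cled|left].
    move=> z zc az zd; have [->|/eqP nzd] := eqVneq z d; first by right.
    case: (N z nzd); [| |by left|by []].
      by case: zd => [//|[zlec _]]; apply: le_trans cled.
    by left; case: az => [|[]].
  have nca : le c a = false.
    by apply/negP => clea; case: (Cz a clea aled).
  rewrite (eq_sym c a) (introF eqP ac) eqxx nca eqxx andbT.
  apply/andP; split; [apply/is_succP|apply/merge_succP]; split; auto.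
    move=> z az zd; have [->|/eqP nzd] := eqVneq z d; first by right.
    by case: (N z nzd zd (or_introl az)) => [|E]; [left|subst z].
  move=> z nzd cz zd; case: (N z nzd).
  - by case: zd => [za|[]//]; apply: le_trans aled.
  - by case: cz => [|[]]; [right|left].
  - by right.
  - by left.
rewrite /two_merges /= !(eq_sym c) (introF eqP ac) (eq_sym d) (introF eqP ad) eqxx andbT.
have nad : le a d -> le c b -> False.
  move=> aled cleb; case: (M2 c cd) => [||E|E]; [by right|by left|by case: ac|by case: bc].
have aleb : le a b by case: M1 => [//|[/nad]].
apply/andP; split; [apply/is_succP|apply/merge_succP]; split; auto.
  move=> z az zb; have [E|/eqP nzd] := eqVneq z d; last by apply: M2 => //; left.
  by subst z; case: (nad az); apply: le_trans zb.
move=> z zb [cz|[cleb az]] [zd|[zleb aled]].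
- exact: Cz.
- by case: (nad aled); apply: le_trans zleb.
- by case: nad => //; apply: le_trans zd.
- by case: nad.
Qed.

End PosetMerge.

(** * Least bricks and the parity of the exponents *)

Section Signs.

Variables (disp : Order.disp_t) (S : finOrderType disp) (W : wall S).
Local Notation A := (bidx W).
Implicit Types (phi psi : cmap W) (a b x y z : A).

Lemma height_lt a b : wall_le a b -> a != b ->
  (height (@wall_le _ _ W) a < height (@wall_le _ _ W) b)%N.
Proof.
move=> ab nab; rewrite /height.
set P := fun x => [pred K : {set A} | [&& is_chain (@wall_le _ _ W) K, x \in K
  & [forall y in K, wall_le y x]]].
have P0 : P a [set a].
  rewrite /P /= set11 /=; apply/andP; split.
    apply/forall_inP=> x /set1P ->; apply/forall_inP=> y /set1P ->.
    by rewrite wall_le_refl.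
  by apply/forall_inP=> x /set1P ->; apply: wall_le_refl.
have PN : (0 < #|P a|)%N by apply/card_gt0P; exists [set a]; exact: P0.
have [K /and3P[chK aK /forall_inP leK] ->] :=
  @eq_bigmax_cond _ (P a) (fun K => #|K|) PN.
have nbK : b \notin K.
  apply: contra nab => /leK ba; apply/eqP/wall_le_anti; rewrite ab; exact: ba.
have Kb y : y \in K -> wall_le y b.
  by move=> /leK ya; exact: connect_trans ya ab.
have -> : #|K|.+1 = #|b |: K| by rewrite cardsU1 nbK.
apply: (@leq_bigmax_cond _ (P b) (fun K => #|K|)).
rewrite /P /= setU11 /=; apply/andP; split; last first.
  by apply/forall_inP=> y /setU1P[->|/Kb //]; apply: wall_le_refl.
apply/forall_inP=> x /setU1P[->|xK]; apply/forall_inP=> y /setU1P[->|yK].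
- by rewrite wall_le_refl.
- by rewrite Kb // orbT.
- by rewrite Kb.
- by have /forall_inP/(_ x xK)/forall_inP := chK; apply.
Qed.

Lemma brick_min_in a : brick_min a \in brick a.
Proof.
by rewrite /brick_min; case: arg_minP => //; apply: (xchooseP (brick_neq0 a)).
Qed.

Local Notation h := (height (@wall_le _ _ W)).

(** Intersecting bricks are comparable, and height is strictly monotone, so all clauses reduce to
    the lexicographic order on height and minimum. *)
Lemma brick_precE a b : brick_prec a b =
  (h a < h b)%N || (h a == h b) && (brick_min a < brick_min b)%O.
Proof.
rewrite /brick_prec; case: ifP => // ab.
have [<-|nab] := eqVneq a b; first by rewrite /strict eqxx ltnn eqxx ltxx.
rewrite /strict nab /=.
have : adj a b by [].
rewrite adj_gstep => /orP[] /connect1 le.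
  by rewrite (height_lt le nab); apply: le.
have lt : (h b < h a)%N by apply: height_lt; rewrite ?(eq_sym b).
rewrite ltnNge (ltnW lt) (gtn_eqF lt) /=; apply/negbTE.
by apply: contra nab => le'; apply/eqP/wall_le_anti; rewrite le' /=; apply: le.
Qed.

Lemma brick_prec_trans : transitive (@brick_prec _ _ W).
Proof.
move=> b a c; rewrite !brick_precE.
case/orP=> [ab|/andP[/eqP -> ab]] /orP[bc|/andP[/eqP bc bc']].
- by rewrite (ltn_trans ab bc).
- by rewrite -bc ab.
- by rewrite bc.
- by rewrite bc eqxx (lt_trans ab bc') orbT.
Qed.

Lemma brick_prec_irr a : brick_prec a a = false.
Proof. by rewrite brick_precE ltnn ltxx andbF. Qed.

(** Bricks with the same minimum intersect, hence are comparable, and then their heights differ. *)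
Lemma brick_prec_total a b : a != b -> brick_prec a b || brick_prec b a.
Proof.
move=> nab; rewrite !brick_precE.
have [||hab] := ltngtP (h a) (h b); rewrite ?orbT //=.
have [||mab] := ltgtP (brick_min a) (brick_min b); rewrite ?orbT //=.
have : adj a b.
  by apply/set0Pn; exists (brick_min a); rewrite inE {2}mab !brick_min_in.
rewrite adj_gstep => /orP[] /connect1 le.
  by have := height_lt le nab; rewrite hab ltnn.
by have := height_lt le; rewrite eq_sym hab ltnn => /(_ nab).
Qed.

Definition brick_rank a : nat := #|[set b | brick_prec b a]|.

Lemma brick_rankE a b : (brick_rank a < brick_rank b)%N = brick_prec a b.
Proof.
have H x y : brick_prec x y -> (brick_rank x < brick_rank y)%N.
  move=> xy; apply/proper_card/properP; split.
    by apply/subsetP=> z; rewrite !inE => zx; apply: brick_prec_trans xy.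
  by exists x; rewrite inE ?brick_prec_irr.
apply/idP/idP; last exact: H.
have [->|nab] := eqVneq a b; first by rewrite ltnn.
have /orP[//|/H ba] := brick_prec_total nab.
by rewrite ltnNge ltnW.
Qed.

Lemma brick_rank_inj : injective brick_rank.
Proof.
move=> a b e; apply/eqP; apply: contraT => /brick_prec_total.
by rewrite -!brick_rankE e ltnn.
Qed.

Definition least phi a : A := [arg min_(k < a | phi k == phi a) brick_rank k].

Definition key phi a := brick_rank (least phi a).

Lemma leastP phi a : phi (least phi a) = phi a /\
  forall k, phi k = phi a -> (key phi a <= brick_rank k)%N.
Proof.
rewrite /key /least; case: arg_minnP => // i /eqP ia imin; split=> // k /eqP.
exact: imin.
Qed.

Lemma least_unique phi a k : phi k = phi a ->
  (forall k', phi k' = phi a -> (brick_rank k <= brick_rank k')%N) -> least phi a = k.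
Proof.
move=> ka kmin; have [la lmin] := leastP phi a.
apply: brick_rank_inj; apply/eqP; rewrite eqn_leq kmin // andbT.
exact: lmin.
Qed.

Lemma eq_least phi psi a b : (forall k, (phi k == phi a) = (psi k == psi b)) ->
  least phi a = least psi b.
Proof.
move=> e; have [la lmin] := leastP psi b.
apply: least_unique => [|k /eqP]; first by apply/eqP; rewrite e la.
by rewrite e => /eqP; apply: lmin.
Qed.

Lemma key_eq phi a b : (key phi a == key phi b) = (phi a == phi b).
Proof.
apply/eqP/eqP=> [/brick_rank_inj e|e].
  by have [<- _] := leastP phi a; rewrite e; have [] := leastP phi b.
by rewrite /key (@eq_least phi phi a b) // => k; rewrite e.
Qed.

Lemma least_id phi a : least phi (least phi a) = least phi a.
Proof. by apply: eq_least => k; have [-> _] := leastP phi a. Qed.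

Lemma col_prec_minE phi a b :
  col_prec_min phi (phi a) (phi b) = (key phi a < key phi b)%N.
Proof.
have [la amin] := leastP phi a; have [lb bmin] := leastP phi b.
apply/exists_inP/idP => [[k /[!inE] /eqP ka /forall_inP kmin]|ab].
  have := kmin (least phi b); rewrite inE lb -brick_rankE => /(_ (eqxx _)).
  by apply: leq_ltn_trans; apply: amin.
exists (least phi a); first by rewrite inE la.
apply/forall_inP=> k /[!inE] /eqP kb; rewrite -brick_rankE.
by apply: leq_trans ab _; apply: bmin.
Qed.

Lemma card_colours_least phi (P : pred A) :
  #|[set c in colours phi | P c]| = #|[set a | (least phi a == a) && P (phi a)]|.
Proof.
rewrite -(@card_in_imset _ _ phi [set a | (least phi a == a) && P (phi a)]).
  apply: eq_card => c; rewrite !inE; apply/andP/imsetP => [[/imsetP[a _ ->] Pa]|].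
    have [la _] := leastP phi a.
    by exists (least phi a); rewrite ?inE ?least_id ?eqxx ?la.
  by case=> a /[!inE] /andP[_ Pa] ->; rewrite imset_f.
move=> a b /[!inE] /andP[/eqP <- _] /andP[/eqP <- _] /eqP; rewrite -key_eq.
by rewrite /key !least_id => /eqP/brick_rank_inj.
Qed.

(** Each colour is counted through its least brick, so this is the number of colours whose key is
    below [n]. *)
Definition nb_below phi n :=
  #|[set a | (least phi a == a) && (brick_rank a < n)%N]|.

Definition sign_exp phi a b : bool :=
  odd (nb_below phi (maxn (key phi a) (key phi b))) (+) (key phi a < key phi b)%N.

(** If [x] has the smaller key, the second count is empty and the first omits just [x]. Otherwise
    the two counts add up to the number of colours below [x]. *)
Lemma odd_Lambda_min phi x y : phi x <> phi y ->
  odd (Lambda_min phi (phi x) (phi y)) = sign_exp phi x y.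
Proof.
move=> /eqP nxy; rewrite /Lambda_min /sign_exp.
have keyl a : least phi a = a -> key phi a = brick_rank a by rewrite /key => ->.
rewrite !card_colours_least.
have -> : [set a | (least phi a == a) &&
      (col_prec_min phi (phi a) (phi y) && (phi a != phi x))]
  = [set a | (least phi a == a) && (brick_rank a < key phi y)%N] :\ least phi x.
  apply/setP=> a; rewrite !inE.
  have [la|_] := eqVneq (least phi a) a; last by rewrite andbF.
  rewrite col_prec_minE (keyl a la) /= [RHS]andbC; congr (_ && ~~ _).
  by rewrite -key_eq (keyl a la) /key (inj_eq brick_rank_inj).
have -> : [set a | (least phi a == a) &&
      (((phi a == phi y) || col_prec_min phi (phi y) (phi a)) &&
       col_prec_min phi (phi a) (phi x))]
  = [set a | (least phi a == a) && (brick_rank a < key phi x)%N] :\: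
    [set a | (least phi a == a) && (brick_rank a < key phi y)%N].
  apply/setP=> a; rewrite !inE.
  have [la|_] := eqVneq (least phi a) a; last by rewrite andbF.
  rewrite !col_prec_minE -key_eq (keyl a la) /= -leqNgt.
  by rewrite [in RHS]leq_eqVlt (eq_sym (key phi y)).
have := cardsD1 (least phi x) [set a | (least phi a == a) && (brick_rank a < key phi y)%N].
rewrite !inE least_id eqxx /= -/(key phi x) -!/(nb_below _ _).
have [xy|yx|/eqP] := ltngtP (key phi x) (key phi y); last by rewrite key_eq (negPf nxy).
  move=> ->; set D := _ :\ least phi x; rewrite (_ : _ :\: _ = set0) ?cards0.
    by rewrite addn0 oddD oddb; case: (odd _).
  apply/setP=> a; rewrite !inE; case: (least phi a == a) => //=.
  by rewrite -leqNgt; apply/negbTE; rewrite negb_and -!ltnNge; lia.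
rewrite add0n => <-; rewrite addbF cardsD (setIidPr _); last first.
  by apply/subsetP=> a; rewrite !inE => /andP[-> /=]; lia.
rewrite -!/(nb_below _ _) subnKC //; apply: subset_leq_card.
by apply/subsetP=> a; rewrite !inE => /andP[-> /=]; lia.
Qed.

Section Merge.

Variables (phi : cmap W) (x y : A).
Hypothesis nxy : phi x <> phi y.
Let psi := col_merge phi (phi x) (phi y).

Lemma key_merge a : key psi a = if (phi a == phi x) || (phi a == phi y)
  then minn (key phi x) (key phi y) else key phi a.
Proof.
have E k : (psi k == psi a) = [|| phi k == phi a,
   (phi k == phi x) && (phi a == phi y) | (phi k == phi y) && (phi a == phi x)].
  exact: col_mergeE.
have [lx xmin] := leastP phi x; have [ly ymin] := leastP phi y.
case: ifP => [axy|/norP[ax ay]]; last first.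
  congr brick_rank; apply: eq_least => k.
  by rewrite E (negPf ax) (negPf ay) !andbF !orbF.
have E' k : (psi k == psi a) = (phi k == phi x) || (phi k == phi y).
  by rewrite E; case/orP: axy => /eqP ->; rewrite eqxx !andbT;
    case: (phi k == phi x); case: (phi k == phi y).
rewrite /minn; case: ltnP => xy; congr brick_rank; apply: least_unique.
- by apply/eqP; rewrite E' lx eqxx.
- move=> k /eqP; rewrite E' => /orP[] /eqP; first exact: xmin.
  by move=> /ymin; apply: leq_trans; apply: ltnW.
- by apply/eqP; rewrite E' ly eqxx orbT.
- move=> k /eqP; rewrite E' => /orP[] /eqP; last exact: ymin.
  by move=> /xmin; apply: leq_trans.
Qed.

(** The merged colour keeps the smaller of the two least bricks, and only the larger one ceases to
    represent a colour. *)
Lemma least_merge a : (least psi a == a) =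
  (least phi a == a) && (brick_rank a != maxn (key phi x) (key phi y)).
Proof.
have lE f b : (least f b == b) = (key f b == brick_rank b).
  by rewrite /key (inj_eq brick_rank_inj).
have [_ /(_ a erefl) amin] := leastP phi a.
rewrite !lE key_merge.
have [||/eqP] := ltngtP (key phi x) (key phi y); last by rewrite key_eq => /eqP.
all: rewrite -!(key_eq phi a); case: ifP; lia.
Qed.

Lemma odd_nb_below_merge n : odd (nb_below psi n) =
  odd (nb_below phi n) (+) (maxn (key phi x) (key phi y) < n)%N.
Proof.
pose z := if (key phi x < key phi y)%N then least phi y else least phi x.
have zE : brick_rank z = maxn (key phi x) (key phi y).
  by rewrite /z /maxn; case: ifP.
have zl : least phi z = z by rewrite /z; case: ifP; rewrite least_id.
rewrite /nb_below (cardsD1 z [set a | (least phi a == a) && (brick_rank a < n)%N]).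
rewrite inE zl eqxx zE /= oddD oddb addbC addbA addbb addFb.
congr (odd _); apply: eq_card => a; rewrite !inE least_merge -zE (inj_eq brick_rank_inj).
by rewrite andbA [(a != z) && _]andbC.
Qed.

Lemma sign_exp_merge a b : sign_exp psi a b =
  odd (nb_below phi (maxn (key psi a) (key psi b)))
    (+) (maxn (key phi x) (key phi y) < maxn (key psi a) (key psi b))%N
    (+) (key psi a < key psi b)%N.
Proof. by rewrite /sign_exp odd_nb_below_merge. Qed.

End Merge.

Lemma eq_sign_exp phi psi a b : kern phi = kern psi ->
  sign_exp phi a b = sign_exp psi a b.
Proof.
move=> /eqP/kernP e.
have l x : least phi x = least psi x by apply: eq_least => k.
rewrite /sign_exp /nb_below /key !l; congr (odd _ (+) _).
by apply: eq_card => x; rewrite !inE l.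
Qed.

End Signs.

(* Parity of the exponents of two successive mergings: [x], [y], then [z], [w] *)
(* are the keys of the merged colours, and [o] is the parity of the number of  *)
(* colours below a given key before the first merging.                         *)
Definition two_exp (o : nat -> bool) (x y z w : nat) : bool :=
  o (maxn x y) (+) (x < y)%N (+)
  (o (maxn z w) (+) (maxn x y < maxn z w)%N (+) (z < w)%N).
(** Splits on every comparison of keys; inconsistent orderings fall to [lia], and the others are
    Boolean identities in the values of [o]. *)
Ltac by_order o :=
  rewrite /two_exp /maxn /minn;
  repeat match goal with |- context [(?a < ?b)%N] => case: (ltnP a b) => ? /= end;
  first [exfalso; lia
        | repeat match goal with |- context [o ?a] => case: (o a) end => //=].
Section TwoExp.
Variables (o : nat -> bool) (x y z w : nat).
Hypotheses (xy : x != y) (xz : x != z) (yz : y != z).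

(** These four identities are the shapes distinguished by [flip_merges]; [minn] is the key of a
    merged colour. *)
Lemma two_exp_chain :
  two_exp o x y (minn x y) z = ~~ two_exp o y z x (minn y z).
Proof. by_order o. Qed.
Lemma two_exp_fork :
  two_exp o x y (minn x y) z = ~~ two_exp o x z (minn x z) y.
Proof. by_order o. Qed.
Lemma two_exp_join :
  two_exp o x y z (minn x y) = ~~ two_exp o z y x (minn z y).
Proof. by_order o. Qed.
Lemma two_exp_disjoint : x != w -> y != w -> z != w ->
  two_exp o x y z w = ~~ two_exp o z w x y.
Proof. move=> xw yw zw; by_order o. Qed.
End TwoExp.

(** * Cancellation of two-step merges *)

Section Complex.

Variables (disp : Order.disp_t) (S : finOrderType disp) (W : wall S).
Local Notation A := (bidx W).
Implicit Types (phi psi : cmap W) (x y : A).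

Lemma col_le_refl phi : reflexive (col_le phi).
Proof. by move=> c; apply: connect0. Qed.

Lemma col_le_trans phi : transitive (col_le phi).
Proof. exact: connect_trans. Qed.

Lemma col_le_anti phi : is_colouring phi -> antisymmetric (col_le phi).
Proof.
by move=> /andP[/forallP H _] c d cd; apply/eqP; have /forallP/(_ d)/implyP := H c; apply.
Qed.

Lemma eq_is_succ (T : finType) (r r' : rel T) : r =2 r' -> is_succ r =2 is_succ r'.
Proof.
move=> e x y; rewrite /is_succ /strict e; congr (_ && ~~ _).
by apply: eq_existsb => z; rewrite !e.
Qed.

Section Merge.

Variables (phi : cmap W) (c d : A).
Hypothesis cd : col_succ phi c d.

Lemma col_le_merge : col_le (col_merge phi c d) =2 merge_le (col_le phi) c d.
Proof.
have [x [y [cE dE]]] := col_succ_colours cd; move: cd; rewrite cE dE => xy a b.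
set psi := col_merge _ _ _.
have psiE u : phi u != phi y -> psi u = phi u by rewrite ffunE => /negPf ->.
have [<-|nab] := eqVneq a b; first by rewrite /merge_le eqxx col_le_refl.
have colE e : e \in colours psi -> e != phi y /\ exists u, e = phi u.
  rewrite (colours_merge xy) in_setD1 => /andP[ey /imsetP[u _ eu]].
  by split=> //; exists u.
have lepsi u v : phi u != phi y -> phi v != phi y ->
    col_le psi (phi u) (phi v) =
    col_le phi (phi u) (phi v) || col_le phi (phi u) (phi y) && col_le phi (phi x) (phi v).
  move=> uy vy; have := col_leE psi u v.
  by rewrite psiE // psiE // => ->; rewrite (qle_merge xy) !col_leE.
rewrite /merge_le (negPf nab) /=; apply/idP/and3P => [ab|[ay bY ab]].
  have /andP[/colE[ay [u au]] /colE[bY [v bv]]] := col_le_colours ab nab.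
  split=> //; move: ay bY ab; rewrite au bv => ay bY.
  by rewrite lepsi.
have [u au] : exists u, a = phi u.
  case/orP: ab => [le|/andP[le _]].
    by have /andP[/imsetP[u _ ->] _] := col_le_colours le nab; exists u.
  by have /andP[/imsetP[u _ ->] _] := col_le_colours le ay; exists u.
have [v bv] : exists v, b = phi v.
  case/orP: ab => [le|/andP[_ le]].
    by have /andP[_ /imsetP[v _ ->]] := col_le_colours le nab; exists v.
  have [<-|xb] := eqVneq (phi x) b; first by exists x.
  by have /andP[_ /imsetP[v _ ->]] := col_le_colours le xb; exists v.
by move: ay bY ab; rewrite au bv => ay bY; rewrite lepsi.
Qed.

Lemma col_succ_merge : col_succ (col_merge phi c d) =2 is_succ (merge_le (col_le phi) c d).
Proof. exact/eq_is_succ/col_le_merge. Qed.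

End Merge.

Definition double_merge phi (w : (A * A) * (A * A)) : cmap W :=
  col_merge (col_merge phi w.1.1 w.1.2) w.2.1 w.2.2.

Lemma kern_flip_merges phi w : two_merges (col_le phi) w ->
  kern (double_merge phi (flip_merges (col_le phi) w)) =
  kern (double_merge phi w).
Proof.
case: w => [[c d] [a b]].
case/andP=> /is_succP[/= cd _ _] /merge_succP[ab [ad bd] _ _].
apply/eqP/kernP => x y; rewrite /flip_merges.
have [E|/eqP ac] := eqVneq a c; last have [E|/eqP bc] := eqVneq b c; do 1?case: ifP => _;
  rewrite /double_merge !ffunE /=; move: (phi x) (phi y) => p q;
  repeat (match goal with |- context [if ?u == ?v then _ else _] =>
    is_var u; is_var v; case: (@eqP _ u v) => ? /= end);
  by apply/eqP/eqP; congruence.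
Qed.

Lemma odd_Lambda_double phi x y u v :
    two_merges (col_le phi) ((phi x, phi y), (phi u, phi v)) ->
  let k a := if (phi a == phi x) || (phi a == phi y)
             then minn (key phi x) (key phi y) else key phi a in
  odd (Lambda_min phi (phi x) (phi y)) (+)
  odd (Lambda_min (col_merge phi (phi x) (phi y)) (phi u) (phi v)) =
  two_exp (fun n => odd (nb_below phi n)) (key phi x) (key phi y) (k u) (k v).
Proof.
case/andP=> /is_succP[/= xy _ _] /merge_succP[uv [uy vy] _ _].
set psi := col_merge _ _ _.
have psiE a : phi a <> phi y -> psi a = phi a by move/eqP/negPf=> ay; rewrite ffunE ay.
have := @odd_Lambda_min _ _ _ psi u v; rewrite (psiE u uy) (psiE v vy) => -> //.
by rewrite odd_Lambda_min // sign_exp_merge // !key_merge.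
Qed.

Lemma odd_Lambda_flip phi w : is_colouring phi -> two_merges (col_le phi) w ->
  let e w := odd (Lambda_min phi w.1.1 w.1.2) (+)
             odd (Lambda_min (col_merge phi w.1.1 w.1.2) w.2.1 w.2.2) in
  e w = ~~ e (flip_merges (col_le phi) w).
Proof.
move=> phiC wP e.
have /andP[fwP _] : two_merges (col_le phi) (flip_merges (col_le phi) w) &&
    (flip_merges (col_le phi) (flip_merges (col_le phi) w) == w).
  by apply: flip_mergesP wP; [exact: col_le_refl|exact: col_le_anti|exact: col_le_trans].
case: w wP fwP => [[c d] [a b]] wP.
have /andP[/col_succ_colours[x [y [/= cE dE]]] abs] := wP.
have [u [v [aE bE]]] : exists u v, a = phi u /\ b = phi v.
  have /andP[/= cds _] := wP; move: abs => /= abs.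
  rewrite -(col_succ_merge cds) in abs.
  have [u [v [/= -> ->]]] := col_succ_colours abs.
  by rewrite !ffunE cE; do 2!case: ifP => _; repeat eexists.
subst; have /andP[/is_succP[/= /eqP xy _ _] /merge_succP[/eqP uv [/eqP uy /eqP vy] _ _]] := wP.
have sym z t : phi z != phi t -> phi t != phi z by rewrite eq_sym.
have neq z t : phi z != phi t -> (phi z == phi t = false) * (phi t == phi z = false).
  by move=> zt; rewrite (negPf zt) (negPf (sym _ _ zt)).
rewrite /flip_merges /e {e}; have [ux|ux] := eqVneq (phi u) (phi x).
  rewrite !ux in wP uv uy * => /=.
  case: ifP => _ fwP; rewrite !odd_Lambda_double // !eqxx
    !(neq _ _ uv) !(neq _ _ uy) !(neq _ _ vy) /=.
    by apply: two_exp_chain; rewrite key_eq // sym.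
  by apply: two_exp_fork; rewrite key_eq // sym.
have [vx|vx] := eqVneq (phi v) (phi x).
  rewrite !vx in wP uv vy * => /=.
  case: ifP => _ fwP; rewrite !odd_Lambda_double // !eqxx
    !(neq _ _ ux) !(neq _ _ uy) !(neq _ _ xy) /=.
    (* The chain identity again, with its two sides exchanged. *)
    by rewrite [X in ~~ X]two_exp_chain ?negbK // key_eq // sym.
  by apply: two_exp_join; rewrite key_eq // sym.
move=> /= fwP; rewrite !odd_Lambda_double //
  !(neq _ _ ux) !(neq _ _ uy) !(neq _ _ vx) !(neq _ _ vy) /=.
by apply: two_exp_disjoint; rewrite key_eq // sym.
Qed.

Definition boundary_coef phi (K : {set A * A}) : int :=
  \sum_(p : A * A | col_succ phi p.1 p.2)
    (kern (col_merge phi p.1 p.2) == K)%:R * (-1) ^+ Lambda_min phi p.1 p.2.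

Lemma incidenceE n (X : {X | X \in Col W n.+1}) (Y : {Y | Y \in Col W n}) :
  incidence (@Lambda_min _ _ W) X Y = boundary_coef (col_repr X) (kern (col_repr Y)).
Proof. by apply: eq_bigr => p _; rewrite mem_class. Qed.

(** Equal partitions have isomorphic sets of colours, along which the sum is reindexed; the
    coefficient can thus be computed on any representative of a class. *)
Lemma eq_boundary_coef phi psi K : kern phi = kern psi ->
  boundary_coef phi K = boundary_coef psi K.
Proof.
move=> e; have /kernP k : kern phi == kern psi by apply/eqP.
have /existsP[F /and4P[_ _ _ /forallP FE]] : col_iso phi psi by rewrite col_isoE e.
have /existsP[G /and4P[_ _ _ /forallP GE]] : col_iso psi phi by rewrite col_isoE e.
rewrite /boundary_coef
  (@reindex_onto _ _ _ _ _ (fun p => (G p.1, G p.2)) (fun p => (F p.1, F p.2))) /=; last first.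
  move=> [c d] /= cd; have [a [b [-> ->]]] := col_succ_colours cd.
  by rewrite !(eqP (FE _)) !(eqP (GE _)).
apply/eq_big => [[c d]|[c d]] /=.
  apply/andP/idP => [[Gs /eqP[Fc Fd]]|cd].
    have [a [b [cE dE]]] := col_succ_colours Gs.
    rewrite cE (eqP (FE _)) in Fc; rewrite dE (eqP (FE _)) in Fd.
    by move: Gs; rewrite -Fc -Fd !(eqP (GE _)) (eq_col_succ _ _ e).
  have [a [b [cE dE]]] := col_succ_colours cd; subst c d.
  by rewrite !(eqP (GE _)) !(eqP (FE _)) (eq_col_succ _ _ e) cd.
case/andP=> Gs /eqP[Fc Fd].
have [a [b [cE dE]]] := col_succ_colours Gs.
rewrite cE (eqP (FE _)) in Fc; rewrite dE (eqP (FE _)) in Fd; subst c d.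
rewrite !(eqP (GE _)) in Gs *.
have [/eqP nab _ _] := col_succP _ _ _ Gs; congr (_%:R * _).
  congr (nat_of_bool (_ == K)).
  by apply/eqP/kernP=> u v; rewrite !col_mergeE !k.
rewrite -signr_odd -[RHS]signr_odd !odd_Lambda_min ?(eq_sign_exp a b e) //.
  by apply/eqP; rewrite -k.
exact/eqP.
Qed.

Lemma sum_flip phi K : is_colouring phi ->
  \sum_(p : A * A | col_succ phi p.1 p.2)
    (-1) ^+ Lambda_min phi p.1 p.2 * boundary_coef (col_merge phi p.1 p.2) K = 0.
Proof.
move=> phiC; pose le := col_le phi.
pose term (w : (A * A) * (A * A)) : int := (kern (double_merge phi w) == K)%:R *
  (-1) ^+ (odd (Lambda_min phi w.1.1 w.1.2) (+)
           odd (Lambda_min (col_merge phi w.1.1 w.1.2) w.2.1 w.2.2)).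
have -> : \sum_(p : A * A | col_succ phi p.1 p.2)
    (-1) ^+ Lambda_min phi p.1 p.2 * boundary_coef (col_merge phi p.1 p.2) K =
    \sum_(w | two_merges le w) term w.
  rewrite /boundary_coef.
  under eq_bigr => p _ do rewrite mulr_sumr.
  rewrite pair_big_dep; apply: eq_big => [[p q]|[p q] /= _].
    rewrite /two_merges /=; case ps: (col_succ phi p.1 p.2); last first.
      by rewrite [is_succ _ _ _]ps.
    by rewrite [is_succ _ _ _]ps /= (col_succ_merge ps).
  rewrite /term /= signr_addb !signr_odd mulrCA; congr (_ * _).
have flipP w : two_merges le w ->
    two_merges le (flip_merges le w) && (flip_merges le (flip_merges le w) == w).
  apply: flip_mergesP; [exact: col_le_refl|exact: col_le_anti|exact: col_le_trans].
(* Reindexing by the involution changes every sign, and an integer equal to its own negative is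
   zero. *)
suff /eqP : \sum_(w | two_merges le w) term w = - \sum_(w | two_merges le w) term w.
  by rewrite -addr_eq0 -mulr2n mulrn_eq0 => /eqP.
rewrite {1}(@reindex_onto _ _ _ _ _ (flip_merges le) (flip_merges le)) /=; last first.
  by move=> w /flipP/andP[_ /eqP].
rewrite -sumrN; apply: eq_big => [w|w].
  apply/andP/idP => [[wP /eqP <-]|/flipP/andP[-> ->]] //.
  by have /andP[] := flipP _ wP.
case/andP=> /flipP/andP[+ _] /eqP E; rewrite E => wP.
rewrite /term (kern_flip_merges wP) (odd_Lambda_flip phiC wP) signrN mulrN opprK.
by [].
Qed.

Lemma Lambda_min_complex : is_complex (@Lambda_min _ _ W).
Proof.
move=> n u; apply/ffunP=> Z; rewrite [RHS]ffunE col_bdryE.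
under eq_bigr => Y _ do rewrite col_bdryE mulr_suml.
rewrite exchange_big big1 // => X _.
under eq_bigr => Y _ do rewrite -mulrA.
rewrite -mulr_sumr -[RHS](mulr0 (u X)); congr (_ * _).
rewrite -[RHS](sum_flip (kern (col_repr Z)) (col_repr_colouring X)).
under eq_bigr => Y _ do rewrite !incidenceE {1}/boundary_coef mulr_suml.
rewrite exchange_big; apply: eq_bigr => p ps.
have [x [y [cE dE]]] := col_succ_colours ps.
(* For a fixed first merge, only the class of the merged colouring contributes to the sum over
   intermediate classes. *)
have [||Y YE] := @class_exists _ _ W n.+1 (col_merge (col_repr X) p.1 p.2).
- by move: ps; rewrite cE dE; apply: is_colouring_merge; apply: col_repr_colouring.
- move: ps; rewrite cE dE => ps; apply: succn_inj.
  by rewrite -(card_colours_merge ps) card_colours_repr.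
rewrite (bigD1 Y) //= YE eqxx mul1r -(eq_boundary_coef _ YE) big1 ?addr0 // => Y' ne.
have [e|] := eqVneq; last by rewrite !mul0r.
by case/eqP: ne; apply: col_repr_inj; rewrite -e YE.
Qed.

End Complex.

Theorem theorem6p15 (disp : Order.disp_t) (S : finOrderType disp)
    (W : wall S) :
  (exists a b : bidx W, is_succ (@wall_le disp S W) a b) ->
  (is_complex (@Lambda disp S W) -> acyclic (@Lambda disp S W)) /\
  (is_complex (@Lambda_min disp S W) /\ acyclic (@Lambda_min disp S W)).
Proof.
move=> succW; split; first exact: complex_acyclic.
by split; [|apply: complex_acyclic => //]; apply: Lambda_min_complex.
Qed.
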